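(* $\ell^1$ is not isomorphic to a subspace of the Banach space $X$ defined in the context.
   Context: **The space $X$.** Let $\mathcal T=\bigcup_{n\ge1}\{(\alpha_1,\dots,\alpha_n):\alpha_i<\omega^\omega\}$ be the tree of nonempty finite sequences of ordinals below $\omega^\omega$, ordered by initial segments ($s>t$ means $t$ is a proper initial segment of $s$), and let $\overline{\mathcal T}$ be $\mathcal T$ together with all infinite sequences of ordinals below $\omega^\omega$. $|s|$ is the length of $s$ and $s(j)$ its $j$-th coordinate. $C_0(\omega^\omega)$ is the space of continuous real functions on the ordinals $\le\omega^\omega$ (order topology) vanishing at $\omega^\omega$, with the sup norm. $X_0$ is the linear space of functions $F=(f_t)_{t\in\mathcal T}$ from $\mathcal T$ to $C_0(\omega^\omega)$ that are nonzero at only finitely many $t$. For $s\in\overline{\mathcal T}$ and an integer $1\le i<|s|$ define the linear functional $$L_{(s,i)}(F)=\sum_{t\in\mathcal T,\ t<s,\ i\le|t|<|s|}f_t\big(s(|t|+1)\big).$$ The pair $(s,i)$ is called a segment and is identified with the set of nodes of length at least $i$ which are above $s$ (i.e. $t<s$, $|t|\ge i$). If $j\le i$, the segments $(s,i)$ and $(t,j)$ are incomparable if they are disjoint and $t(m)\ne s(m)$ for some $m\le j$. Put $$\|F\|=\sup\Big\{\Big(\sum_j\big[L_{(s_j,i_j)}(F)\big]^2\Big)^{1/2}:\{(s_j,i_j)\}\text{ pairwise incomparable segments}\Big\}.$$ $X$ is the completion of $X_0$ under this norm. *)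

(* Defs.v *)
From HB Require Import structures.
From mathcomp Require Import all_boot all_order all_algebra.
From mathcomp Require Import finmap.
From mathcomp Require Import all_classical all_reals all_analysis.
From mathcomp Require Import ring lra.

Set Implicit Arguments.
Unset Strict Implicit.
Unset Printing Implicit Defensive.

Import Order.TTheory GRing.Theory Num.Theory.
Import Order.DefaultSeqLexiOrder.
Import numFieldNormedType.Exports.

Local Open Scope classical_set_scope.
Local Open Scope ring_scope.

Fact ord_display : Order.disp_t. Proof. exact: Order.Disp tt tt. Qed.

(* An ordinal below omega^omega, in Cantor normal form: the nonincreasing
   sequence [:: e_1; ...; e_k] stands for omega^e_1 + ... + omega^e_k.  The
   order of ordinals is the lexicographic order on these sequences, in which a
   proper prefix of a sequence is smaller than the sequence. *)
Record ord : Type := Ord {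
  cnf : seq nat;
  _ : sorted geq cnf }.

HB.instance Definition _ := [isSub for cnf].
HB.instance Definition _ := [Choice of ord by <:].
HB.instance Definition _ := [SubChoice_isSubOrder of ord by <: with ord_display].

Definition ord0 : ord := @Ord [::] isT.

(* The ordinals at most omega^omega: [None] is omega^omega. *)
Definition ordtop : Type := option ord.

HB.instance Definition _ := Choice.on ordtop.

Definition ordtop_le (x y : ordtop) : bool :=
  match x, y with
  | _, None => true
  | None, Some _ => false
  | Some a, Some b => (a <= b)%O
  end.

Definition ordtop_lt (x y : ordtop) : bool := (y != x) && ordtop_le x y.

Fact ordtop_lt_def x y : ordtop_lt x y = (y != x) && ordtop_le x y.
Proof. by []. Qed.

Fact ordtop_le_anti : antisymmetric ordtop_le.
Proof. by move=> [a|] [b|]//= /le_anti ->. Qed.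

Fact ordtop_le_trans : transitive ordtop_le.
Proof. by move=> [b|] [a|] [c|]//=; exact: le_trans. Qed.

Fact ordtop_le_total : total ordtop_le.
Proof. by move=> [a|] [b|]//=; exact: le_total. Qed.

HB.instance Definition _ := Order.isOrder.Build ord_display ordtop
  ordtop_lt_def (fun _ _ => erefl) (fun _ _ => erefl)
  ordtop_le_anti ordtop_le_trans ordtop_le_total.

Section OrdWf.

Let lts (s t : seq nat) : Prop := sorted geq s /\ (s < t)%O.

Let geq_tr : transitive geq.
Proof. by move=> y x z /= yx zy; exact: leq_trans yx. Qed.

Let sorted_all n x (s : seq nat) :
  sorted geq (x :: s) -> (x < n)%N -> all (fun y => y < n)%N (x :: s).
Proof.
rewrite /= (path_sortedE geq_tr) => /andP[/allP xs _] xn; rewrite xn /=.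
by apply/allP => y /xs /= yx; exact: leq_ltn_trans xn.
Qed.

Let lt_nseq_cat n k (s t : seq nat) : sorted geq t -> sorted geq s ->
    all (fun y => y < n)%N s -> (t < nseq k n ++ s)%O ->
  exists j t', [/\ t = nseq j n ++ t', sorted geq t',
    all (fun y => y < n)%N t' & (j < k)%N \/ j = k /\ (t' < s)%O].
Proof.
move=> st ss sn; elim: k t st => [|k IH] [|x t] st /=.
- by exists 0%N, [::]; split=> //; right.
- case: s ss sn => [|y s] ss //= /andP[yn _].
  rewrite Order.SeqLexiOrder.ltxi_cons => /andP[]; rewrite leEnat => xy lt.
  exists 0%N, (x :: t); split => //.
    by apply: sorted_all => //; exact: leq_ltn_trans yn.
  by right; split=> //; rewrite Order.SeqLexiOrder.ltxi_cons leEnat xy.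
- by exists 0%N, [::]; split=> //; left.
- rewrite Order.SeqLexiOrder.ltxi_cons !leEnat => /andP[xn lt].
  have [xn'|nx] := ltnP x n.
    by exists 0%N, (x :: t); split=> //; [exact: sorted_all|left].
  have xE : x = n by apply/eqP; rewrite eqn_leq xn.
  have [||j [t' [tE t's t'n h]]] := IH t.
  - by move: st => /=; exact: path_sorted.
  - by move: lt; rewrite nx.
  exists j.+1, t'; split=> //; first by rewrite tE xE.
  by case: h => [jk|[-> ?]]; [left|right].
Qed.

Let acc_lts n (s : seq nat) :
  sorted geq s -> all (fun y => y < n)%N s -> Acc lts s.
Proof.
elim: n s => [|n IH] s.
  by case: s => [|//] _ _; constructor=> t [_]; rewrite Order.SeqLexiOrder.ltxis0.
have key k s' : sorted geq s' -> all (fun y => y < n)%N s' ->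
    Acc lts (nseq k n ++ s').
  elim/ltn_ind: k s' => k IHk s' ss' sn'.
  have := IH s' ss' sn'; move=> a; elim: a ss' sn' => {}s' _ IHs ss' sn'.
  constructor=> t [st lt].
  have [j [t' [-> st' tn' [jk|[-> tlt]]]]] := lt_nseq_cat st ss' sn' lt.
    exact: IHk.
  by apply: IHs => //; split.
move=> ss sn.
have [j [t' [-> st' tn' _]]] : exists j t', [/\ s = nseq j n ++ t', sorted geq t',
    all (fun y => y < n)%N t' & True].
  elim: s ss sn => [|x s IHs] ss /=; first by exists 0%N, [::].
  rewrite ltnS => /andP[xn sn].
  have [xn'|nx] := ltnP x n.
    by exists 0%N, (x :: s); split=> //; exact: sorted_all.
  have xE : x = n by apply/eqP; rewrite eqn_leq xn.
  have [||j [t' [-> ? ? _]]] := IHs.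
  - exact: path_sorted ss.
  - exact: sn.
  by exists j.+1, t'; rewrite xE.
exact: key.
Qed.

Lemma ord_wf : well_founded (fun x y : ord => (x < y)%O).
Proof.
move=> x; have : Acc lts (cnf x).
  case: x => s ss /=; apply: (@acc_lts (\max_(i <- s) i).+1) => //.
  by apply/allP => y ys; rewrite ltnS; exact: leq_bigmax_seq.
move E : (cnf x) => s a.
elim: a x E => {}s _ IH x E; constructor=> y yx; apply: (IH (cnf y)) => //.
by split; [case: y {yx}|rewrite -E].
Qed.

Lemma ordtop_wf : well_founded (fun x y : ordtop => (x < y)%O).
Proof.
have acc (x : ord) : Acc (fun x y : ordtop => (x < y)%O) (Some x).
  elim: (ord_wf x) => {}x _ IH; constructor=> -[y|] yx; last by [].
  apply: IH; move: yx.
  by rewrite !lt_neqAle => /andP[yx1 yx2]; apply/andP; split.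
case=> [x|]; first exact: acc.
by constructor=> -[y|//] _; exact: acc.
Qed.

End OrdWf.

Section C0.
Variable R : realType.

Definition C0_pred : {pred ordtop -> R^o} := mem
  [set f | continuous (f : order_topology ordtop -> R) /\ f None = 0].

Record C0 : Type := MkC0 {
  C0_fun :> ordtop -> R^o;
  _ : C0_fun \in C0_pred }.

HB.instance Definition _ := [isSub for C0_fun].
HB.instance Definition _ := [Choice of C0 by <:].

Fact C0_submod_closed : submod_closed C0_pred.
Proof.
split; first by rewrite inE; split=> //; exact: cst_continuous.
move=> a f g; rewrite !inE => -[cf f0] [cg g0]; split.
  move=> x; apply: (@continuousD _ _ (order_topology ordtop) (a *: f) g).
    apply: (@continuousZl_tmp _ _ (order_topology ordtop) f a); exact: cf.
  exact: cg.
by rewrite [LHS](_ : _ = a *: f None + g None)// f0 g0 scaler0 addr0.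
Qed.

HB.instance Definition _ :=
  GRing.isSubmodClosed.Build R (ordtop -> R^o) C0_pred C0_submod_closed.
HB.instance Definition _ := [SubChoice_isSubLmodule of C0 by <:].

End C0.

Definition node : Type := {s : seq ord | s != [::]}.
HB.instance Definition _ := Choice.on node.

Definition node_length (t : node) : nat := size (val t).

(* Finite or infinite sequences; [coord s j] is the j-th coordinate of [s],
   for 1 <= j <= |s|. *)
Definition branch : Type := (node + (nat -> ord))%type.
HB.instance Definition _ := Choice.on branch.

(* n < |s| *)
Definition lt_length (n : nat) (s : branch) : bool :=
  match s with inl t => (n < node_length t)%N | inr _ => true end.

Definition coord (s : branch) (j : nat) : ord :=
  match s with inl t => nth ord0 (val t) j.-1 | inr x => x j.-1 end.

(* t < s : t is a proper initial segment of s. *)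
Definition precedes (t : node) (s : branch) : Prop :=
  lt_length (node_length t) s /\
  forall j, (1 <= j <= node_length t)%N -> coord (inl t) j = coord s j.

Section X0.
Variable R : realType.

Definition X0_pred : {pred node -> C0 R} := mem
  [set F | finite_set [set t | F t != 0]].

Record X0 : Type := MkX0 {
  X0_fun :> node -> C0 R;
  _ : X0_fun \in X0_pred }.

HB.instance Definition _ := [isSub for X0_fun].
HB.instance Definition _ := [Choice of X0 by <:].

Fact X0_submod_closed : submod_closed X0_pred.
Proof.
split.
  by rewrite inE /=; apply: sub_finite_set (finite_set0 node) => t /=; rewrite eqxx.
move=> a F G; rewrite !inE /= => fF fG.
apply: (sub_finite_set _ (_ : finite_set ([set t | F t != 0] `|` [set t | G t != 0]))).
  move=> t /=; have [F0|F0] := eqVneq (F t) 0; last by left.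
  have [G0|G0] := eqVneq (G t) 0; last by right.
  by rewrite [X in X != _](_ : _ = a *: F t + G t)// F0 G0 scaler0 addr0 eqxx.
by rewrite finite_setU.
Qed.

HB.instance Definition _ :=
  GRing.isSubmodClosed.Build R (node -> C0 R) X0_pred X0_submod_closed.
HB.instance Definition _ := [SubChoice_isSubLmodule of X0 by <:].

Definition is_segment (p : branch * nat) : Prop :=
  (1 <= p.2)%N /\ lt_length p.2 p.1.

Definition segment_nodes (p : branch * nat) : set node :=
  [set t | precedes t p.1 /\ (p.2 <= node_length t)%N].

(* The condition |t| < |s| is part of t < s; only the finitely many t with
   F t != 0 contribute, and the sum is over those. *)
Definition Lfunctional (p : branch * nat) (F : X0) : R :=
  \sum_(t \in segment_nodes p) F t (Some (coord p.1 (node_length t).+1)).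

(* The coordinates numbered up to the smaller of the two indices are
   compared, which covers both orders of the indices. *)
Definition incomparable (p q : branch * nat) : Prop :=
  segment_nodes p `&` segment_nodes q = set0 /\
  exists m, (1 <= m <= minn p.2 q.2)%N /\ coord p.1 m <> coord q.1 m.

Definition incomparable_family (S : set (branch * nat)) : Prop :=
  (forall p, S p -> is_segment p) /\
  forall p q, S p -> S q -> p <> q -> incomparable p q.

(* The families may be infinite; their segments are disjoint, so that only
   finitely many terms of each sum are nonzero (incomparable_family_finite),
   and the supremum is finite (X0_norm_has_ubound). *)
Definition X0_norm (F : X0) : R :=
  sup [set Num.sqrt (\sum_(p \in S) Lfunctional p F ^+ 2)
      | S in incomparable_family].

End X0.

Section L2.
Context {R : realType} {I : eqType}.
Implicit Types (r : seq I) (a b : I -> R).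

Lemma sqrt_sumsqD r a b :
  Num.sqrt (\sum_(i <- r) (a i + b i) ^+ 2) <=
  Num.sqrt (\sum_(i <- r) a i ^+ 2) + Num.sqrt (\sum_(i <- r) b i ^+ 2).
Proof.
set A := Num.sqrt (\sum_(i <- r) a i ^+ 2).
set B := Num.sqrt (\sum_(i <- r) b i ^+ 2).
have A0 : 0 <= A by exact: sqrtr_ge0.
have B0 : 0 <= B by exact: sqrtr_ge0.
have sA : \sum_(i <- r) a i ^+ 2 = A ^+ 2.
  by rewrite sqr_sqrtr// sumr_ge0// => i _; exact: sqr_ge0.
have sB : \sum_(i <- r) b i ^+ 2 = B ^+ 2.
  by rewrite sqr_sqrtr// sumr_ge0// => i _; exact: sqr_ge0.
rewrite -[leRHS]ger0_norm ?addr_ge0// -sqrtr_sqr ler_sqrt ?sqr_ge0//.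
have -> : \sum_(i <- r) (a i + b i) ^+ 2 =
    A ^+ 2 + B ^+ 2 + 2 * \sum_(i <- r) a i * b i.
  rewrite -sA -sB mulr_sumr -!big_split /=; apply: eq_bigr => i _.
  by rewrite sqrrD mulr_natl addrAC.
rewrite sqrrD -[in leRHS]mulr_natl [leRHS]addrAC lerD2l ler_pM2l//.
have [A00|A_neq0] := eqVneq A 0.
  have a0 : forall i, i \in r -> a i = 0.
    move: sA; rewrite A00 expr0n /= => /eqP.
    rewrite psumr_eq0; last by move=> i _; exact: sqr_ge0.
    by move=> /allP h i /h /=; rewrite sqrf_eq0 => /eqP.
  rewrite A00 mul0r big_seq big1// => i /a0 ->; exact: mul0r.
have [B00|B_neq0] := eqVneq B 0.
  have b0 : forall i, i \in r -> b i = 0.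
    move: sB; rewrite B00 expr0n /= => /eqP.
    rewrite psumr_eq0; last by move=> i _; exact: sqr_ge0.
    by move=> /allP h i /h /=; rewrite sqrf_eq0 => /eqP.
  rewrite B00 mulr0 big_seq big1// => i /b0 ->; exact: mulr0.
have AB : 0 < A * B by rewrite mulr_gt0// lt0r ?A_neq0 ?B_neq0.
rewrite -(ler_pM2l AB).
have -> : A * B * (A * B) = 2^-1 * (B ^+ 2 * A ^+ 2 + A ^+ 2 * B ^+ 2).
  by field.
rewrite -{1}sA -{2}sB !mulr_sumr -big_split /= mulr_sumr ler_sum// => i _.
rewrite -subr_ge0.
have -> : 2^-1 * (B ^+ 2 * a i ^+ 2 + A ^+ 2 * b i ^+ 2) - A * B * (a i * b i)
  = 2^-1 * (B * a i - A * b i) ^+ 2 by field.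
by rewrite mulr_ge0// ?sqr_ge0// invr_ge0.
Qed.

Lemma sqrt_sumsq_le_sum r a :
  Num.sqrt (\sum_(i <- r) a i ^+ 2) <= \sum_(i <- r) `|a i|.
Proof.
elim: r => [|i r IH]; first by rewrite !big_nil sqrtr0.
rewrite !big_cons.
have h : 0 <= \sum_(j <- r) `|a j| by exact: sumr_ge0.
rewrite -[leRHS]ger0_norm ?addr_ge0// -sqrtr_sqr ler_sqrt ?sqr_ge0//.
rewrite sqrrD real_normK ?num_real// -addrA lerD2l.
apply: le_trans (_ : (\sum_(j <- r) `|a j|) ^+ 2 <= _); last first.
  by rewrite lerDr mulrn_wge0// mulr_ge0.
rewrite -ler_sqrt ?sqr_ge0// sqrtr_sqr (ger0_norm h)//.
Qed.

End L2.

Section X0_norm_theory.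
Context {R : realType}.
Implicit Types (F G : X0 R) (S : set (branch * nat)) (p q : branch * nat).

Lemma C0_bounded (f : C0 R) : exists M : R, forall x, `|f x| <= M.
Proof.
suff H x : exists M : R, forall y : ordtop, (y <= x)%O -> `|f y| <= M.
  have [M HM] := H None; exists M => x; apply: HM; by case: x.
elim: (ordtop_wf x) => {}x _ IH.
have [cf _] : continuous (C0_fun f : order_topology ordtop -> R) /\ C0_fun f None = 0.
  by case: f {IH} => f /=; rewrite inE.
have /= := cf x _ (nbhsx_ballx (f x) 1 ltr01).
rewrite nbhs_simpl /= itv_nbhsE => -[[l r] [oi xi] sub].
have near_le (y : ordtop) : y \in Interval l r -> `|f y| <= `|f x| + 1.
  move=> yi; have := sub y yi; rewrite /ball /= => fxy.
  have -> : f y = f x - (f x - f y) by rewrite opprB addrC subrK.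
  by rewrite (le_trans (ler_normB _ _))// lerD2l ltW.
have rx (y : ordtop) : (y <= x)%O ->
    match r with BSide c d => (y < d ?<= if ~~ c)%O | BInfty c => ~~ c end.
  move=> yx; move: xi; rewrite in_itv => /andP[_].
  case: r oi {sub near_le} => [c d|c] oi /=; last by rewrite (itv_open_ends_rinfty oi).
  by rewrite (itv_open_ends_rside oi) /=; exact: le_lt_trans.
case: l oi xi {sub} near_le rx => [b a|b] oi xi near_le rx; last first.
  exists (`|f x| + 1) => y yx; apply: near_le.
  rewrite in_itv (itv_open_ends_linfty oi) /=; exact: rx.
have b0 := itv_open_ends_lside oi; rewrite b0 in xi near_le rx.
have ax : (a < x)%O by move: xi; rewrite in_itv /= => /andP[].
have [M HM] := IH a ax.
exists (Num.max M (`|f x| + 1)) => y yx; rewrite le_max.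
have [ya|ay] := leP y a; first by rewrite HM.
apply/orP; right; apply: near_le; rewrite in_itv /= ay /=; exact: rx.
Qed.

Let node_val p (t : node) : ordtop := Some (coord p.1 (node_length t).+1).

Lemma X0_finite F : finite_set [set t | F t != 0].
Proof. by case: F => F /=; rewrite inE. Qed.

Lemma Lfunctional_seq p F (r : seq node) : uniq r ->
    (forall t, F t != 0 -> t \in r) ->
  Lfunctional p F =
  \sum_(t <- r) if t \in segment_nodes p then F t (node_val p t) else 0.
Proof.
move=> ur Fr; rewrite fsbig_seq// /Lfunctional [LHS]fsbig_mkcond.
rewrite [LHS](_ : _ = \sum_(t \in setT) if t \in segment_nodes p then F t (node_val p t) else 0) //.
apply/esym/fsbig_widen => //.
move=> t [_ /= tr]; case: ifP => // _.
have [F0|/Fr //] := eqVneq (F t) 0; by rewrite F0.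
Qed.

Let supp2 F G := fset_set ([set t | F t != 0] `|` [set t | G t != 0]).

Let mem_supp2 F G t : (t \in supp2 F G) = (F t != 0) || (G t != 0).
Proof.
rewrite /supp2 in_fset_set; last by rewrite finite_setU; split; exact: X0_finite.
by apply/idP/orP; rewrite inE.
Qed.

Lemma Lfunctional_linear p : linear (@Lfunctional R p : X0 R -> R^o).
Proof.
move=> a F G; have u := fset_uniq (supp2 F G).
rewrite !(@Lfunctional_seq _ _ (supp2 F G) u).
- rewrite scaler_sumr -big_split /=; apply: eq_bigr => t _.
  by case: ifP => _ //; rewrite scaler0 addr0.
- by move=> t; rewrite mem_supp2 => ->; rewrite orbT.
- by move=> t; rewrite mem_supp2 => ->.
- move=> t; rewrite mem_supp2; apply: contraNT; rewrite negb_or !negbK.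
  move=> /andP[/eqP F0 /eqP G0].
  by rewrite [X in X == _](_ : _ = a *: F t + G t)// F0 G0 scaler0 addr0.
Qed.

Lemma Lfunctional_neq0 p F : Lfunctional p F != 0 ->
  exists2 t, segment_nodes p t & F t != 0.
Proof.
apply: contra_neqP => /forall2NP h; apply: fsbig1 => t pt.
by have [//|/negP/negPn/eqP ->] := h t.
Qed.

Lemma incomparable_family_finite S F : incomparable_family S ->
  finite_set [set p | S p /\ Lfunctional p F != 0].
Proof.
move=> [_ Sinc]; set A := [set p | _].
have [g gP] : {g : branch * nat -> node | forall p, A p ->
    segment_nodes p (g p) /\ F (g p) != 0}.
  have /choice[g gP] : forall p, exists t, A p -> segment_nodes p t /\ F t != 0.
    move=> p; have [Ap|nAp] := pselect (A p).
      by have [t pt Ft] := Lfunctional_neq0 Ap.2; exists t.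
    by have [t _] : exists t : node, True; [by exists (exist _ [:: ord0] isT)|exists t].
  by exists g.
have ginj : {in A &, injective g}.
  move=> p q; rewrite !inE => Ap Aq gpq; apply: contrapT => pq.
  have [disj _] := Sinc _ _ Ap.1 Aq.1 pq.
  have : (segment_nodes p `&` segment_nodes q) (g p).
    by split; [exact: (gP _ Ap).1|rewrite gpq; exact: (gP _ Aq).1].
  by rewrite disj.
rewrite -(eq_finite_set (inj_card_eq ginj)).
by apply: sub_finite_set (X0_finite F) => _ [p Ap <-]; exact: (gP _ Ap).2.
Qed.

Lemma sumsq_seq S F (r : seq (branch * nat)) : uniq r ->
    (forall p, p \in r -> S p) -> (forall p, S p -> Lfunctional p F != 0 -> p \in r) ->
  \sum_(p \in S) Lfunctional p F ^+ 2 = \sum_(p <- r) Lfunctional p F ^+ 2.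
Proof.
move=> ur rS Sr; rewrite [RHS]fsbig_seq//; apply/esym/fsbig_widen.
  by move=> p /rS.
move=> p [Sp /= pr]; apply/eqP; rewrite sqrf_eq0; apply/negPn/negP => /(Sr _ Sp).
exact: pr.
Qed.

Lemma X0_norm_has_ubound F : has_ubound
  [set Num.sqrt (\sum_(p \in S) Lfunctional p F ^+ 2) | S in incomparable_family].
Proof.
have [M HM] : {M : node -> R | forall t x, `|F t x| <= M t}.
  have /choice[M HM] : forall t, exists M : R, forall x, `|F t x| <= M.
    by move=> t; exact: C0_bounded.
  by exists M.
have M0 t : 0 <= M t by exact: le_trans (normr_ge0 _) (HM t None).
set D := fset_set [set t | F t != 0].
have FD t : F t != 0 -> t \in D.
  by move=> Ft; rewrite in_fset_set ?inE//; exact: X0_finite.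
exists (\sum_(t <- D) M t) => _ [S incS <-].
have fA := incomparable_family_finite F incS.
set r := fset_set [set p | S p /\ Lfunctional p F != 0].
have rP p : p \in r = `[< S p /\ Lfunctional p F != 0 >].
  by rewrite in_fset_set// inE; apply/idP/asboolP; rewrite inE.
rewrite (@sumsq_seq _ _ r (fset_uniq _)).
- apply: le_trans (sqrt_sumsq_le_sum _ _) _.
  apply: (@le_trans _ _ (\sum_(p <- r) \sum_(t <- D)
      if t \in segment_nodes p then M t else 0)).
    apply: ler_sum => p _; rewrite (Lfunctional_seq p (fset_uniq _) FD).
    apply: le_trans (ler_norm_sum _ _ _) _; apply: ler_sum => t _.
    by case: ifP => _; rewrite ?normr0.
  rewrite exchange_big /=; apply: ler_sum => t _.
  have [[p pr tp]|none] := pselect (exists2 p, p \in r & t \in segment_nodes p).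
    rewrite (big_rem p pr) /= tp big_seq big1 ?addr0// => q qr.
    case: ifP => // tq; exfalso.
    move: (qr); rewrite (mem_rem_uniq _ (fset_uniq _)) inE => /andP[/eqP qp qr'].
    move: pr qr'; rewrite !rP => /asboolP[Sp _] /asboolP[Sq _].
    have [disj _] := incS.2 _ _ Sq Sp qp.
    by have : (segment_nodes q `&` segment_nodes p) t; [split; exact: set_mem|rewrite disj].
  rewrite big_seq big1// => p pr; case: ifP => // tp.
  by exfalso; apply: none; exists p.
- by move=> p; rewrite rP => /asboolP[].
- by move=> p Sp L0; rewrite rP; apply/asboolP.
Qed.

Lemma X0_norm_ub S F : incomparable_family S ->
  Num.sqrt (\sum_(p \in S) Lfunctional p F ^+ 2) <= X0_norm F.
Proof.
by move=> incS; apply: ub_le_sup; [exact: X0_norm_has_ubound|exists S].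
Qed.

Lemma incomparable_family0 : incomparable_family set0.
Proof. by []. Qed.

Lemma X0_norm_ge0 F : 0 <= X0_norm F.
Proof. exact: le_trans (sqrtr_ge0 _) (X0_norm_ub F incomparable_family0). Qed.

Lemma X0_norm_le F (M : R) :
  (forall S, incomparable_family S ->
    Num.sqrt (\sum_(p \in S) Lfunctional p F ^+ 2) <= M) -> X0_norm F <= M.
Proof.
move=> h; apply: ge_sup.
  by exists (Num.sqrt (\sum_(p \in set0) Lfunctional p F ^+ 2)); exists set0.
by move=> _ [S incS <-]; exact: h.
Qed.

Fact X0_norm_triangle F G : X0_norm (F + G) <= X0_norm F + X0_norm G.
Proof.
apply: X0_norm_le => S incS.
set A := [set p | S p /\ Lfunctional p F != 0] `|`
         [set p | S p /\ Lfunctional p G != 0].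
have fA : finite_set A.
  by rewrite finite_setU; split; exact: incomparable_family_finite.
have u := fset_uniq (fset_set A).
have rS p : p \in fset_set A -> S p by rewrite in_fset_set// inE => -[[]|[]].
have LD p : Lfunctional p (F + G) = Lfunctional p F + Lfunctional p G.
  by have := Lfunctional_linear p 1 F G; rewrite !scale1r.
have hF p : S p -> Lfunctional p F != 0 -> p \in fset_set A.
  by move=> Sp L0; rewrite in_fset_set// inE; left.
have hG p : S p -> Lfunctional p G != 0 -> p \in fset_set A.
  by move=> Sp L0; rewrite in_fset_set// inE; right.
have hFG p : S p -> Lfunctional p (F + G) != 0 -> p \in fset_set A.
  move=> Sp; rewrite LD; have [L0|L0] := eqVneq (Lfunctional p F) 0.
    by rewrite L0 add0r; exact: hG.
  by move=> _; exact: hF.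
apply: le_trans (lerD (X0_norm_ub F incS) (X0_norm_ub G incS)).
rewrite (sumsq_seq u rS hF) (sumsq_seq u rS hG) (sumsq_seq u rS hFG).
under eq_bigr do rewrite LD.
exact: sqrt_sumsqD.
Qed.

Let LfunctionalZ p (a : R) F : Lfunctional p (a *: F) = a * Lfunctional p F.
Proof.
have L0 : Lfunctional p 0 = 0 :> R.
  by rewrite /Lfunctional fsbig1.
by have := Lfunctional_linear p a F 0; rewrite L0 !addr0.
Qed.

Fact X0_normZ (a : R) F : X0_norm (a *: F) = `|a| * X0_norm F.
Proof.
have le_normZ (b : R) G : X0_norm (b *: G) <= `|b| * X0_norm G.
  apply: X0_norm_le => S incS.
  have fA := incomparable_family_finite G incS.
  set r := fset_set [set p | S p /\ Lfunctional p G != 0].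
  have rS p : p \in r -> S p by rewrite in_fset_set// inE => -[].
  have rG p : S p -> Lfunctional p G != 0 -> p \in r.
    by move=> Sp L0; rewrite in_fset_set// inE.
  have rbG p : S p -> Lfunctional p (b *: G) != 0 -> p \in r.
    by move=> Sp; rewrite LfunctionalZ mulf_eq0 negb_or => /andP[_]; exact: rG.
  rewrite (sumsq_seq (fset_uniq _) rS rbG).
  under eq_bigr do rewrite LfunctionalZ exprMn.
  rewrite -mulr_sumr sqrtrM ?sqr_ge0// sqrtr_sqr ler_wpM2l//.
  by rewrite -(sumsq_seq (fset_uniq _) rS rG); exact: X0_norm_ub.
apply/eqP; rewrite eq_le le_normZ /=.
have [->|a0] := eqVneq a 0; first by rewrite normr0 mul0r X0_norm_ge0.
rewrite -[in leLHS](scalerK a0 F) -ler_pdivlMl ?normr_gt0// -normfV.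
exact: le_normZ.
Qed.

Fact X0_norm0_eq0 F : X0_norm F = 0 -> F = 0.
Proof.
move=> F0; apply/val_inj/funext => t; apply/val_inj/funext => -[a|]; last first.
  have f0 (f : C0 R) : C0_fun f None = 0 by case: f => f /=; rewrite inE => -[].
  exact: f0.
have sz (s : seq ord) : rcons s a != [::] by case: s.
pose p : branch * nat := (inl (exist _ (rcons (val t) a) (sz _)), node_length t).
have segp : is_segment p.
  split; first by rewrite /= /node_length; case: t {p} => -[].
  by rewrite /= /node_length /= size_rcons.
have incp : incomparable_family [set p].
  by split=> [_ ->//|_ _ -> ->].
have nodesp : segment_nodes p = [set t].
  apply/seteqP; split=> u /=.
    move=> [[/= + h] tu]; rewrite /node_length /= size_rcons ltnS => ut.
    have utE : node_length u = node_length t by apply/eqP; rewrite eqn_leq ut.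
    apply/val_inj/(@eq_from_nth _ ord0) => // i iu.
    have := h i.+1; rewrite /= nth_rcons => -> //.
    by rewrite -[X in (_ < X)%N]utE iu.
  move=> ->; split=> //; split=> [|j /andP[j0 jt]].
    by rewrite /= /node_length /= size_rcons.
  by rewrite /= nth_rcons prednK// jt.
have : Lfunctional p F = 0.
  have := X0_norm_ub F incp; rewrite F0 fsbig_set1 sqrtr_sqr normr_le0.
  by move/eqP.
rewrite /Lfunctional nodesp fsbig_set1 /= nth_rcons ltnn eqxx.
by [].
Qed.

End X0_norm_theory.

HB.instance Definition _ (R : realType) :=
  Lmodule_isNormed.Build R (X0 R) (@X0_norm_triangle R) (@X0_normZ R) (@X0_norm0_eq0 R).

Section l1.
Variable R : realType.

Definition l1_pred : {pred nat -> R^o} := mem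
  [set a : nat -> R^o | cvgn [normed series a]].

Record l1 : Type := Mkl1 {
  l1_seq :> nat -> R^o;
  _ : l1_seq \in l1_pred }.

HB.instance Definition _ := [isSub for l1_seq].
HB.instance Definition _ := [Choice of l1 by <:].

Fact l1_submod_closed : submod_closed l1_pred.
Proof.
split.
  rewrite inE /=; apply: (cvgP 0); rewrite [X in X @ _](_ : _ = cst 0); first exact: cvg_cst.
  by apply/funext => n /=; rewrite /series /= big1// => i _; rewrite normr0.
move=> c a b; rewrite !inE /= => ca cb.
apply: (@series_le_cvg _ _ (`|c| *: (fun n => `|a n|) + (fun n => `|b n|))).
- by move=> n; exact: normr_ge0.
- by move=> n; rewrite addr_ge0// mulr_ge0.
- by move=> n; rewrite (le_trans (ler_normD _ _))// lerD2r normrZ.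
- by apply: is_cvg_seriesD => //; exact: is_cvg_seriesZ.
Qed.

HB.instance Definition _ :=
  GRing.isSubmodClosed.Build R (nat -> R^o) l1_pred l1_submod_closed.
HB.instance Definition _ := [SubChoice_isSubLmodule of l1 by <:].

Definition l1_norm (a : l1) : R := limn [normed series a].

Let l1_cvg (a : l1) : cvgn [normed series a].
Proof. by case: a => a /=; rewrite inE. Qed.

Fact l1_norm_triangle a b : l1_norm (a + b) <= l1_norm a + l1_norm b.
Proof.
rewrite /l1_norm -lim_seriesD//; [|exact: l1_cvg..].
apply: lim_series_le.
- exact: l1_cvg.
- by apply: is_cvg_seriesD; exact: l1_cvg.
- by move=> n; exact: (ler_normD (a n) (b n)).
Qed.

Fact l1_normZ (c : R) a : l1_norm (c *: a) = `|c| * l1_norm a.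
Proof.
rewrite /l1_norm -[RHS]lim_seriesZ; last exact: l1_cvg.
congr (limn (series _)); apply/funext => n.
by rewrite [LHS](_ : _ = `|c *: (a n)|)// normrZ.
Qed.

Fact l1_norm0_eq0 a : l1_norm a = 0 -> a = 0.
Proof.
move=> a0; apply/val_inj/funext => n.
have : [normed series a] n.+1 <= 0.
  rewrite -a0; apply: nondecreasing_cvgn_le; last exact: l1_cvg.
  by apply: nondecreasing_series => k _ _; exact: normr_ge0.
rewrite /= /series /= big_nat_recr//= => h.
apply/eqP; rewrite -normr_le0 (le_trans _ h)// lerDr sumr_ge0//.
Qed.

HB.instance Definition _ :=
  Lmodule_isNormed.Build R l1 l1_norm_triangle l1_normZ l1_norm0_eq0.

End l1.

Section Embeddings.
Variable R : realType.

Definition is_completion (V : normedModType R) (X : completeNormedModType R)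
    (iota : {linear V -> X}) : Prop :=
  (forall v, `|iota v| = `|v|) /\ dense (range iota).

(* A linear homeomorphism of E onto the subspace [range T] of F. *)
Definition isomorphic_to_subspace (E F : normedModType R) : Prop :=
  exists (T : {linear E -> F}) (S : F -> E),
    [/\ continuous T, cancel T S & {within range T, continuous S}].

End Embeddings.

(* Main.v *)
From HB Require Import structures.
Require Import Defs.
From mathcomp Require Import all_boot all_order all_algebra.
From mathcomp Require Import finmap.
From mathcomp Require Import all_classical all_reals all_analysis.
From mathcomp Require Import ring lra.

Set Implicit Arguments.
Unset Strict Implicit.
Unset Printing Implicit Defensive.

Import Order.TTheory GRing.Theory Num.Theory.
Import numFieldNormedType.Exports.
(* [coord] and [ord0] also name notions on vector spaces and finite ordinals;
   below they are those of branches and of ordinals. *)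
Import Defs.

Local Open Scope classical_set_scope.
Local Open Scope ring_scope.

(** An isomorphic copy of l1 inside X gives, after a small perturbation, a
    bounded sequence (F_k) in the dense subspace X0 with
    [|sum_k a_k F_k| >= d * sum_k |a_k|] for some d > 0
    ([completion_l1_sequence]).  No bounded sequence of X0 has this property:
    for each N there are coefficients with [sum_k |a_k| = N] and
    [|sum_k a_k F_k| <= C * sqrt N] ([slow_growth]).

    The source of the square root is that the norm is an l2-norm over disjoint
    segments.  A fixed element H of X0 is finitely supported, so that only
    boundedly many segments of a disjoint family see it; if G is uniformly small
    on all segments, then [|H + G|^2] is at most [|H|^2 + |G|^2 + 1]
    ([X0_normD_almost_orthogonal]).  It remains to find, in the span of any
    tail of a bounded sequence, an element with coefficients of total mass 1 that
    is uniformly small on all segments ([small_lcomb]).  A segment functional is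
    the difference of two functionals L_s that sum along a branch s from its
    first node on ([Lfunctional_truncation]), so it is enough to be small on
    all branches, finite or infinite.  This is done in three moves.

    - Finite branches are countable in number, and finitely many linear
      conditions can be met exactly by a combination of mass 1
      ([lcomb_kernel]).  This gives successive blocks y_n of the sequence on which
      each finite branch vanishes from some n on.

    - On such a block sequence, only boundedly many infinite branches can be
      large at once: r distinct branches separate at a finite level m, their tails
      beyond m are incomparable segments, and L_s agrees with its tail when the
      finite branch cut at level m vanishes; hence r * theta^2 <= M^2
      ([few_large_branches]).  On a subsequence only finitely many branches keep
      being large, and these can be annihilated exactly.  The resulting blocks
      z_n are eventually small on each single branch.

    - Pointwise smallness becomes uniform after one more convex-like
      combination.  If it did not, Ptak's combinatorial argument ([ptak]) would give
      an infinite set of indices k such that each finite part of it has a branch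
      that is large at all z_k of that part.  The branches form a compact space
      for the topology induced by X0 ([ultra_branch_lim]), because the ordinals
      at most omega^omega form one and the functions f_t are continuous and
      vanish at omega^omega.  So a single branch would be large at infinitely many z_k,
      a contradiction. *)

(** * Combinations of mass one and block sequences *)

Lemma increasing_ge (p : nat -> nat) : {homo p : i j / (i < j)%N} ->
  forall n, (n <= p n)%N.
Proof.
by move=> p_lt; elim=> // n IH; exact: leq_ltn_trans IH (p_lt _ _ (ltnSn n)).
Qed.

Section Blocks.
Context {R : realType} {V : lmodType R}.
Implicit Types (F y z : nat -> V) (G H : V) (w : R).

(** The weight w is the l1-norm of the coefficients, whatever their signs; it
    bounds every seminorm of G in terms of the F k. *)
Definition lcomb F (m n : nat) w G : Prop :=
  exists a : nat -> R, G = \sum_(m <= k < n) a k *: F k /\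
    \sum_(m <= k < n) `|a k| = w.

(** Every y n has mass one, so that a combination of the y n is a combination of
    the F k with the same mass ([blocks_lcomb]). *)
Definition blocks F y : Prop :=
  exists p : nat -> nat, forall n, lcomb F (p n) (p n.+1) 1 (y n).

Definition is_seminorm (N : V -> R) : Prop :=
  (forall u v, N (u + v) <= N u + N v) /\ (forall a u, N (a *: u) = `|a| * N u).

Lemma lcomb_empty F m : lcomb F m m 0 0.
Proof. by exists (fun=> 0); rewrite !big_geq. Qed.

Lemma lcomb_single F m : lcomb F m m.+1 1 (F m).
Proof. by exists (fun=> 1); rewrite !big_nat1 scale1r normr1. Qed.

Lemma lcomb_scale F m n w G c :
  lcomb F m n w G -> lcomb F m n (`|c| * w) (c *: G).
Proof.
move=> [a [-> <-]]; exists (fun k => c * a k); split.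
  by rewrite scaler_sumr; apply: eq_bigr => k _; rewrite scalerA.
by rewrite mulr_sumr; apply: eq_bigr => k _; rewrite normrM.
Qed.

Lemma lcomb_cat F m n q w w' G H : (m <= n <= q)%N ->
  lcomb F m n w G -> lcomb F n q w' H -> lcomb F m q (w + w') (G + H).
Proof.
move=> /andP[mn nq] [a [-> <-]] [b [-> <-]].
exists (fun k => if (k < n)%N then a k else b k).
split; rewrite (big_cat_nat mn nq) /=; congr (_ + _).
- by apply: eq_big_nat => k /andP[_ ->].
- by apply: eq_big_nat => k /andP[nk _]; rewrite ltnNge nk.
- by apply: eq_big_nat => k /andP[_ ->].
- by apply: eq_big_nat => k /andP[nk _]; rewrite ltnNge nk.
Qed.

Lemma lcomb_null F m n : lcomb F m n 0 0.
Proof.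
by exists (fun=> 0); rewrite !big1// => k _; rewrite ?normr0// scale0r.
Qed.

Lemma lcomb_widenr F m n q w G : (m <= n <= q)%N ->
  lcomb F m n w G -> lcomb F m q w G.
Proof.
move=> mnq FG; rewrite -[w]addr0 -[G]addr0.
exact: lcomb_cat FG (lcomb_null F n q).
Qed.

Lemma lcomb_widenl F m n q w G : (m <= n <= q)%N ->
  lcomb F n q w G -> lcomb F m q w G.
Proof.
move=> mnq FG; rewrite -[w]add0r -[G]add0r.
exact: lcomb_cat (lcomb_null F m n) FG.
Qed.

Lemma lcomb1_lt F m n G : lcomb F m n 1 G -> (m < n)%N.
Proof.
move=> [a [_ h]]; rewrite ltnNge; apply/negP => nm; move: h.
by rewrite big_geq// => /eqP; rewrite eq_sym oner_eq0.
Qed.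

Lemma lcomb_shift F c m n w G :
  lcomb (fun k => F (k + c)%N) m n w G <-> lcomb F (m + c) (n + c) w G.
Proof.
split=> -[a [-> <-]].
  by exists (fun k => a (k - c)%N); split; rewrite big_addn addnK;
    apply: eq_bigr => k _; rewrite addnK.
by exists (fun k => a (k + c)%N); split; rewrite big_addn addnK.
Qed.

Lemma lcomb_le (N : V -> R) F m n w G c : is_seminorm N -> lcomb F m n w G ->
  (forall k, (m <= k < n)%N -> N (F k) <= c) -> N G <= w * c.
Proof.
move=> [ND NZ] [a [-> <-]] h; rewrite big_distrl /=.
have N0 : N 0 = 0 by rewrite -(scale0r 0) NZ normr0 mul0r.
apply: (@le_trans _ _ (\sum_(m <= k < n) N (a k *: F k))).
  elim/big_ind2 : _ => [|x u x' u' ux u'x'|//]; first by rewrite N0.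
  by rewrite (le_trans (ND _ _))// lerD.
rewrite [leLHS]big_nat_cond [leRHS]big_nat_cond; apply: ler_sum => k.
by rewrite andbT => /h ?; rewrite NZ ler_wpM2l.
Qed.

Lemma blocks_lcomb F y p (h : forall n, lcomb F (p n) (p n.+1) 1 (y n)) m n w G :
  (m <= n)%N -> lcomb y m n w G -> lcomb F (p m) (p n) w G.
Proof.
have pm : {homo p : i j / (i <= j)%N}.
  by apply: homo_leq => //; [exact: leq_trans|move=> i; exact/ltnW/lcomb1_lt/h].
move=> mn [a [-> <-]]; elim: n mn => [|n IH].
  by rewrite leqn0 => /eqP ->; rewrite !big_geq//; exact: lcomb_empty.
rewrite leq_eqVlt => /predU1P[->|]; first by rewrite !big_geq//; exact: lcomb_empty.
rewrite ltnS => mn; rewrite !big_nat_recr//=.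
apply: (@lcomb_cat _ _ (p n)); first by rewrite !pm.
  exact: IH.
by rewrite -[X in lcomb _ _ _ X]mulr1; exact/lcomb_scale/h.
Qed.

Lemma blocks_lt F y p (h : forall n, lcomb F (p n) (p n.+1) 1 (y n)) :
  {homo p : i j / (i < j)%N}.
Proof. by apply: homo_ltn => [|i]; [exact: ltn_trans|exact/lcomb1_lt/h]. Qed.

Lemma blocks_ge F y p (h : forall n, lcomb F (p n) (p n.+1) 1 (y n)) n :
  (n <= p n)%N.
Proof. exact/increasing_ge/(blocks_lt h). Qed.

Lemma blocks_trans F y z : blocks F y -> blocks y z -> blocks F z.
Proof.
move=> [p hp] [q hq]; exists (p \o q) => n.
exact: (blocks_lcomb hp (ltnW (lcomb1_lt (hq n)))).
Qed.

Lemma blocks_refl F : blocks F F.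
Proof. by exists id => n; exact: lcomb_single. Qed.

Lemma blocks_shift F y c : blocks F y -> blocks F (fun k => y (k + c)%N).
Proof. by move=> [p h]; exists (fun n => p (n + c)%N) => n; exact: h. Qed.

Lemma blocks_exist F (P : nat -> V -> Prop) :
  (forall m i, exists n G, lcomb F m n 1 G /\ P i G) ->
  exists2 y, blocks F y & forall i, P i (y i).
Proof.
move=> h; have /choice[f hf] : forall x : nat * nat, exists nG : nat * V,
    lcomb F x.1 nG.1 1 nG.2 /\ P x.2 nG.2.
  by move=> [m i]; have [n [G ?]] := h m i; exists (n, G).
pose p := fix p i := if i is i'.+1 then (f (p i', i')).1 else 0%N.
exists (fun i => (f (p i, i)).2); last by move=> i; exact: (hf (p i, i)).2.
by exists p => i; exact: (hf (p i, i)).1.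
Qed.

(** Two successive combinations G and H, of mass one, always have a combination
    of mass one on which a given functional phi vanishes: take coefficients
    proportional to phi(H) and - phi(G).  Conditions that hold on both G and H are
    kept, which allows an induction on the list of functionals. *)
Lemma lcomb_kernel (I : eqType) (phi : I -> V -> R) F (r : seq I) m :
  (forall i a u v, phi i (a *: u + v) = a * phi i u + phi i v) ->
  exists n G, lcomb F m n 1 G /\ forall i, i \in r -> phi i G = 0.
Proof.
move=> phiL; elim: r m => [|i r IH] m.
  by exists m.+1, (F m); split=> //; exact: lcomb_single.
have [n [G [FG G0]]] := IH m; have [q [H [FH H0]]] := IH n.
have mnq : (m <= n <= q)%N by rewrite (ltnW (lcomb1_lt FG)) (ltnW (lcomb1_lt FH)).
have phi0 j : phi j 0 = 0.
  have /eqP := phiL j 1 0 0.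
  by rewrite scaler0 addr0 mul1r addrC -subr_eq subrr eq_sym => /eqP.
have phiZ j a u : phi j (a *: u) = a * phi j u.
  by rewrite -[_ *: u]addr0 phiL phi0 addr0.
have [Gi|Gi] := eqVneq (phi i G) 0.
  by exists n, G; split=> // j; rewrite inE => /predU1P[->//|]; exact: G0.
have d0 : 0 < `|phi i H| + `|phi i G| by rewrite ltr_wpDl// normr_gt0.
exists q, ((phi i H / (`|phi i H| + `|phi i G|)) *: G +
           (- phi i G / (`|phi i H| + `|phi i G|)) *: H).
split=> [|j jr].
  have -> : 1 = `|phi i H / (`|phi i H| + `|phi i G|)| * 1 +
                `|- phi i G / (`|phi i H| + `|phi i G|)| * 1.
    by rewrite !mulr1 !normrM normrN normfV (gtr0_norm d0) -mulrDl divff ?gt_eqF.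
  exact: lcomb_cat mnq (lcomb_scale _ FG) (lcomb_scale _ FH).
rewrite phiL phiZ.
move: jr; rewrite inE => /predU1P[->|jr]; first by ring.
by rewrite (G0 j)// (H0 j)// !mulr0 addr0.
Qed.

End Blocks.

(** * From pointwise to uniform smallness *)

Section Ptak.
Context {R : realType} {V : lmodType R} {Gam : Type}.
Variables (N : Gam -> V -> R) (z : nat -> V) (M theta : R).
Hypothesis snN : forall s, is_seminorm (N s).
Hypothesis theta0 : 0 <= theta.
Hypothesis zM : forall s k, N s (z k) <= M.
Implicit Types (y : nat -> V) (G H : V) (s : Gam) (sg : seq nat) (eta : R).

Let hit sg s : Prop := forall k, k \in sg -> theta <= N s (z k).

(** Quantifying over all block sequences of z, and not only over z, is what
    makes tameness of finitely many sets simultaneous ([tame_seq]). *)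
Let tame sg : Prop := forall y eta, blocks z y -> 0 < eta ->
  exists n G, lcomb y 0 n 1 G /\ forall s, hit sg s -> N s G <= theta + eta.

Let lcomb_bound m n G : lcomb z m n 1 G -> forall s, N s G <= M.
Proof. by move=> zG s; rewrite -[M]mul1r; exact: lcomb_le (snN s) zG _. Qed.

Let lcomb_hit m n G s : lcomb z m n 1 G -> theta < N s G ->
  exists2 k, (m <= k < n)%N & theta <= N s (z k).
Proof.
move=> zG; apply: contraPP => h; apply/negP; rewrite -leNgt -[theta]mul1r.
apply: lcomb_le (snN s) zG _ => k mkn; rewrite leNgt; apply/negP => hk.
by apply: h; exists k => //; exact: ltW.
Qed.

Let tame_seq (sgs : seq (seq nat)) : (forall sg, sg \in sgs -> tame sg) ->
  forall y eta m, blocks z y -> 0 < eta -> exists n G, lcomb y m n 1 G /\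
  (forall sg, sg \in sgs -> forall s, hit sg s -> N s G <= theta + eta).
Proof.
elim: sgs => [|sg sgs IH] tsgs y eta m zy eta0.
  by exists m.+1, (y m); split=> //; exact: lcomb_single.
have [|c [p hp] cP] := @blocks_exist _ _ (fun k => y (k + m)%N) (fun _ G =>
    forall sg, sg \in sgs -> forall s, hit sg s -> N s G <= theta + eta).
  move=> q _; have [|n [G [yG GP]]] := IH _ y eta (q + m)%N zy eta0.
    by move=> sg' h; apply: tsgs; rewrite inE h orbT.
  have qn := lcomb1_lt yG.
  exists (n - m)%N, G; split=> //; apply/lcomb_shift.
  by rewrite subnK// (leq_trans _ (ltnW qn))// leq_addl.
have yc : blocks z c.
  apply: (blocks_trans (blocks_shift m zy)); by exists p.
have [n [G [cG GP]]] := tsgs sg (mem_head _ _) c eta yc eta0.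
exists (p n + m)%N, G; split.
  apply: (@lcomb_widenl _ _ _ _ (p 0 + m)%N).
    by rewrite leq_addl leq_add2r ltnW// (blocks_lt hp)// (lcomb1_lt cG).
  by apply/lcomb_shift; exact: (blocks_lcomb hp (ltnW (lcomb1_lt cG))).
move=> sg'; rewrite inE => /predU1P[->|h] s hs; first exact: GP.
rewrite -[leRHS]mul1r; apply: lcomb_le (snN s) cG _ => k _; exact: cP hs.
Qed.

(** Take L successive combinations.  At a point s hit by sg, consider the first
    one that exceeds theta; one of its indices k has [theta <= N s (z k)].  The
    later ones were chosen after k was known, for the set sg extended by k, and
    are almost at most theta at s; so only one of the L combinations is large at
    s, and its share in the average is at most M / L. *)
Let tame_step sg :
  (forall k, (forall j, j \in sg -> (j < k)%N) -> tame (rcons sg k)) -> tame sg.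
Proof.
move=> tsg y eta [p hp] eta0.
pose K := (\max_(j <- sg) j).+1.
have KP k : (K <= k)%N -> tame (rcons sg k).
  move=> Kk; apply: tsg => j jsg; apply: leq_trans Kk.
  by rewrite ltnS; exact: leq_bigmax_seq.
have eta2 : 0 < eta / 2 by rewrite divr_gt0.
have key : forall L, exists n H, [/\ lcomb y K (K + n) L%:R H &
    forall s, hit sg s -> N s H <= L%:R * theta \/
      N s H <= L%:R * (theta + eta / 2) + M /\
      exists2 k, (K <= k < p (K + n))%N & theta <= N s (z k)].
  elim=> [|L [n [H [yH HP]]]].
    exists 0%N, 0; rewrite addn0; split; first exact: lcomb_empty.
    move=> s _; left; rewrite mul0r.
    by have := (snN s).2 0 0; rewrite scale0r normr0 mul0r => ->.
  have tsgs sg' : sg' \in [seq rcons sg k | k <- iota K (p (K + n)%N - K)] ->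
      tame sg'.
    by move=> /mapP[k]; rewrite mem_iota => /andP[Kk _] ->; exact: KP.
  have [q [G [yG GP]]] := tame_seq tsgs (K + n)%N (ex_intro _ p hp) eta2.
  have nq := lcomb1_lt yG.
  have qE : q = (K + (q - K))%N.
    by rewrite subnKC// (leq_trans _ (ltnW nq))// leq_addr.
  have zG := blocks_lcomb hp (ltnW nq) yG.
  exists (q - K)%N, (H + G); rewrite -qE; split.
    rewrite -natr1; apply: lcomb_cat yH yG.
    by rewrite leq_addr ltnW.
  have M_ge s : hit sg s -> N s G <= M by move=> _; exact: lcomb_bound zG s.
  move=> s hs; have NHG := (snN s).1 H G.
  have pq : (p (K + n) < p q)%N by exact: (blocks_lt hp).
  have [Hl|[Hl [k kn hk]]] := HP s hs.
    have [Gl|Gg] := lerP (N s G) theta; [left|right].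
      rewrite -(natr1 L) mulrDl mul1r; lra.
    have [k kn hk] := lcomb_hit zG Gg.
    split.
      have := M_ge s hs; have : 0 <= L%:R * (eta / 2) by rewrite mulr_ge0// ltW.
      rewrite -(natr1 L) mulrDl mul1r mulrDr => Lc GM; have t0 := theta0; lra.
    exists k => //.
    move/andP: kn => [nk ->]; rewrite andbT (leq_trans _ nk)//.
    by rewrite (leq_trans (leq_addr n K))// (blocks_ge hp).
  right; split.
    have := GP (rcons sg k); rewrite map_f; last first.
      rewrite mem_iota; move/andP: kn => [-> kn] /=; rewrite subnKC//.
      by rewrite (leq_trans (leq_addr n K))// (blocks_ge hp).
    move=> /(_ isT s); have hks : hit (rcons sg k) s.
      by move=> j; rewrite mem_rcons inE => /predU1P[->//|/hs].
    move=> /(_ hks) ?; rewrite -(natr1 L) mulrDl mul1r; lra.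
  exists k => //; move/andP: kn => [-> kn] /=; exact: ltn_trans pq.
pose L := (Num.truncn (M / (eta / 2))).+1.
have L0 : 0 < L%:R :> R by rewrite ltr0n.
have ML : M <= L%:R * (eta / 2).
  by rewrite -ler_pdivrMr//; apply/ltW/truncnS_gt.
have [n [H [yH HP]]] := key L.
exists (K + n)%N, (L%:R^-1 *: H); split.
  have yH0 : lcomb y 0 (K + n) L%:R H by apply: lcomb_widenl yH; rewrite leq_addr.
  have := lcomb_scale L%:R^-1 yH0.
  by rewrite ger0_norm ?invr_ge0 ?(ltW L0)// mulVf// gt_eqF.
move=> s hs; rewrite (snN s).2 ger0_norm ?invr_ge0 ?(ltW L0)//.
rewrite ler_pdivrMl//.
have Leta : 0 <= L%:R * (eta / 2) by rewrite mulr_ge0// ltW.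
rewrite mulrDr [eta]splitr mulrDr.
have [|[]] := HP s hs; first lra.
rewrite mulrDr; lra.
Qed.

(** Ptak's combinatorial lemma for a family of seminorms.  If the empty set of
    indices were not tame, then [tame_step] would extend it, one larger index at
    a time, to an increasing sequence all of whose initial parts are not
    tame; such a part hits some point, since otherwise the condition in
    [tame] would be void. *)
Lemma ptak :
  (forall kappa : nat -> nat, {homo kappa : i j / (i < j)%N} ->
    exists n, forall s, exists2 i, (i < n)%N & N s (z (kappa i)) < theta) ->
  forall eta, 0 < eta ->
    exists n G, lcomb z 0 n 1 G /\ forall s, N s G <= theta + eta.
Proof.
move=> hz; suff t0 : tame [::].
  move=> eta eta0; have [n [G [zG GP]]] := t0 z eta (blocks_refl z) eta0.
  by exists n, G; split=> // s; apply: GP.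
apply: contrapT => t0.
have /choice[f fP] : forall sg, exists k, ~ tame sg ->
    (forall j, j \in sg -> (j < k)%N) /\ ~ tame (rcons sg k).
  move=> sg; have [tsg|ntsg] := pselect (tame sg); first by exists 0%N.
  apply: contrapT => h; apply: ntsg; apply: tame_step => k sgk.
  by apply: contrapT => ntk; apply: h; exists k.
pose sgm := fix sgm i := if i is i'.+1 then rcons (sgm i') (f (sgm i')) else [::].
have ntame i : ~ tame (sgm i) by elim: i => //= i /fP[].
pose kappa i := f (sgm i).
have kappa_in n i : (i < n)%N -> kappa i \in sgm n.
  elim: n => // n IH; rewrite ltnS leq_eqVlt /= mem_rcons inE.
  by move=> /predU1P[->|/IH ->]; rewrite ?eqxx ?orbT.
have kappa_lt : {homo kappa : i j / (i < j)%N}.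
  by move=> i j ij; apply: (fP _ (ntame j)).1; exact: kappa_in.
have [n nP] := hz kappa kappa_lt.
apply: (ntame n) => y eta _ _; exists 1%N, (y 0%N); split.
  exact: lcomb_single.
move=> s hs; have [i iltn] := nP s.
by rewrite ltNge hs// kappa_in.
Qed.
End Ptak.

(** * Compactness of the space of branches *)

Section UltraLimits.
Context {R : realType}.

Lemma itv_open_le d (T : orderType d) (l r : itv_bound T) (b x : T) :
  itv_open_ends (Interval l r) -> b \in Interval l r -> (x <= b)%O ->
  (forall c a, l = BSide c a -> (a < x)%O) -> x \in Interval l r.
Proof.
move=> oi; rewrite !in_itv /= => /andP[bl br] xb lx.
apply/andP; split.
  case: l oi lx bl => [c a|//] oi lx _.
  by rewrite (itv_open_ends_lside oi) /=; exact: lx.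
case: r oi br {lx bl} => [c d'|c] oi //=.
by rewrite (itv_open_ends_rside oi) /=; exact: le_lt_trans.
Qed.

(** The limit is the least beta such that [u x <= beta] for almost all x.  It
    exists by well-foundedness, and u almost always lies in the interval from any
    l < beta to beta. *)
Lemma ultra_ordtop_lim {T : Type} (U : set_system T) {UU : UltraFilter U}
    (u : T -> ordtop) :
  exists beta : ordtop, forall f : C0 R, (fun x => f (u x)) @ U --> (f beta : R).
Proof.
have FU : Filter U := filter_filter.
have [beta Ub lb] : exists2 beta, U [set x | u x <= beta]%O &
    forall l, (l < beta)%O -> U [set x | (l < u x)%O].
  suff H b : U [set x | u x <= b]%O -> exists2 beta, U [set x | u x <= beta]%O &
      forall l, (l < beta)%O -> U [set x | (l < u x)%O].
    by apply: (H None); apply: filterS filterT => x _ /=; case: (u x).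
  elim: (ordtop_wf b) => {}b _ IH Ub.
  have [[c cb Uc]|h] := pselect (exists2 c, (c < b)%O & U [set x | u x <= c]%O).
    exact: IH Uc.
  exists b => // l lb; have [Ul|] := in_ultra_setVsetC [set x | u x <= l]%O UU.
    by exfalso; apply: h; exists l.
  by apply: filterS => x /= /negP; rewrite -ltNge.
exists beta => f.
have [cf _] : continuous (C0_fun f : order_topology ordtop -> R) /\ C0_fun f None = 0.
  by case: f => f /=; rewrite inE.
suff h : (u : T -> order_topology ordtop) @ U --> (beta : order_topology ordtop).
  exact: (cvg_comp _ _ h (cf beta)).
move=> A; rewrite itv_nbhsE => -[i [oi bi] sub].
case: i oi bi sub => l r oi bi sub.
suff Ui : U [set x | (u x : order_topology ordtop) \in Interval l r].
  by apply: filterS Ui => x; exact: sub.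
have Ul : U [set x | forall c a, l = BSide c a ->
    (a < (u x : order_topology ordtop))%O].
  case: l oi bi {sub} => [c a|c] oi bi; last exact: filterS filterT.
  have ab : (a < beta)%O.
    by move: bi; rewrite in_itv (itv_open_ends_lside oi) => /andP[].
  by apply: filterS (lb a ab) => x /= ax c' a' [_ <-].
apply: filterS2 Ub Ul => x ux lx.
exact: (@itv_open_le _ (order_topology ordtop) l r beta (u x) oi bi ux lx).
Qed.

End UltraLimits.

Section BranchCompact.
Context {R : realType}.
Implicit Types (s : branch) (t : node) (w : seq ord) (F : X0 R) (p : branch * nat).

Definition initial s n : seq ord := mkseq (fun i => coord s i.+1) n.

Definition ge_length n s : bool :=
  match s with inl t => (n <= node_length t)%N | inr _ => true end.

Lemma lt_lengthE n s : lt_length n s = ge_length n.+1 s.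
Proof. by case: s. Qed.

Lemma ge_lengthS m n s : (m <= n)%N -> ge_length n s -> ge_length m s.
Proof. by case: s => //= t; exact: leq_trans. Qed.

Lemma initial_take m n s : (m <= n)%N -> take m (initial s n) = initial s m.
Proof. by move=> mn; rewrite /initial /mkseq -map_take take_iota (minn_idPl mn). Qed.

Lemma initial_rcons n s : initial s n.+1 = rcons (initial s n) (coord s n.+1).
Proof. by rewrite /initial mkseqS. Qed.

Lemma initial_inl t : initial (inl t) (node_length t) = val t.
Proof.
by rewrite /initial /=; apply: (@eq_from_nth _ ord0) => [|i];
  rewrite size_mkseq// => it; rewrite nth_mkseq.
Qed.

Lemma precedesE t s :
  precedes t s <-> ge_length (node_length t).+1 s /\ initial s (node_length t) = val t.
Proof.
rewrite /precedes lt_lengthE; split=> -[ts h]; split=> //.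
  apply: (@eq_from_nth _ ord0) => [|i]; rewrite size_mkseq// => it.
  by rewrite nth_mkseq//; have := h i.+1 => /= <-.
move=> [//|j] /= jt; rewrite -h nth_mkseq//.
Qed.

Lemma precedes_inr t (x : nat -> ord) :
  precedes t (inr x) <-> mkseq x (node_length t) = val t.
Proof. by rewrite precedesE; split=> [[]|]. Qed.

Lemma precedes_inl t t' : precedes t (inl t') <->
  (node_length t < node_length t')%N /\ take (node_length t) (val t') = val t.
Proof.
rewrite precedesE /= -(initial_inl t'); split=> -[tt' <-]; split=> //.
  by rewrite initial_take// ltnW.
by rewrite initial_take// ltnW.
Qed.

(** The contribution of the node t to L_s F when F takes the value f at t.  It
    is the continuity of these terms in s that makes the space of branches
    compact. *)
Definition Lterm t (f : C0 R) s : R :=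
  if `[< precedes t s >] then f (Some (coord s (node_length t).+1)) else 0.

Lemma node_length_gt0 t : (0 < node_length t)%N.
Proof. by case: t => -[]. Qed.

Lemma Lfunctional1E F s (r : seq node) : uniq r -> (forall t, F t != 0 -> t \in r) ->
  Lfunctional (s, 1%N) F = \sum_(t <- r) Lterm t (F t) s.
Proof.
move=> ur Fr; rewrite (Lfunctional_seq _ ur Fr); apply: eq_bigr => t _.
rewrite /Lterm; congr (if _ then _ else _).
apply/idP/asboolP; rewrite inE /segment_nodes /=; first by case.
by move=> ts; split=> //; exact: node_length_gt0.
Qed.

Definition eventually_extends (U : set_system branch) w :=
  U [set s | ge_length (size w) s /\ initial s (size w) = w].

Section Ultra.
Variable U : set_system branch.
Hypothesis UU : UltraFilter U.

Let FU : ProperFilter U := ultra_proper.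

Let stable := eventually_extends U.

Let stable_take w n : stable w -> (n <= size w)%N -> stable (take n w).
Proof.
move=> Uw nw; apply: filterS Uw => s [/= sw sE].
rewrite size_takel//; split; first exact: ge_lengthS sw.
by rewrite -[in RHS]sE initial_take.
Qed.

Let stable_uniq w w' : stable w -> stable w' -> size w = size w' -> w = w'.
Proof.
move=> Uw Uw' ww'; have [s [[_ <-] [_ <-]]] := filter_ex (filterI Uw Uw').
by rewrite ww'.
Qed.

Let Lterm_near_eq t f s : U [set s' | Lterm t f s' = Lterm t f s] ->
  Lterm t f @ U --> (Lterm t f s : R).
Proof. by move=> h; apply: cvg_near_cst. Qed.

Let Lterm_prefix t f s w : (node_length t < size w)%N -> stable w ->
  w = initial s (size w) -> ge_length (size w) s ->
  Lterm t f @ U --> (Lterm t f s : R).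
Proof.
move=> tw Uw ws sw; apply: Lterm_near_eq; apply: filterS Uw => s' [/= s'w s'E].
have E : initial s' (size w) = initial s (size w) by rewrite s'E.
rewrite /Lterm; have -> : coord s' (node_length t).+1 = coord s (node_length t).+1.
  by move/(congr1 (nth ord0 ^~ (node_length t))): E; rewrite !nth_mkseq.
congr (if _ then _ else _); apply: asbool_equiv_eq; rewrite !precedesE.
rewrite -(initial_take s' (ltnW tw)) E (initial_take s (ltnW tw)).
by split=> -[_ ?]; split=> //; [exact: ge_lengthS sw|exact: ge_lengthS s'w].
Qed.

(** Follow the coordinates that are constant almost everywhere.  If this never
    stops, they form an infinite branch, which is the limit.  Otherwise let w be
    the longest sequence that almost all branches extend.  Either almost all
    branches equal w, or the next coordinate is not almost constant and
    has a limit beta at most omega^omega.  A node beyond w fixes this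
    coordinate and is almost never on the branch, and the term of w itself tends
    to [f beta]: the limit is w followed by beta, or w alone if
    beta = omega^omega, where f vanishes. *)
Lemma ultra_branch_lim : exists s, forall t (f : C0 R),
  Lterm t f @ U --> (Lterm t f s : R).
Proof.
have stable0 : stable [::] by apply: filterS filterT => -[].
have [hW|] := pselect (forall n, exists w, size w = n /\ stable w).
  have /choice[W WP] := hW.
  pose x i := nth ord0 (W i.+1) i.
  have WE n : W n = initial (inr x) n.
    apply: (@eq_from_nth _ ord0) => [|i]; rewrite (WP n).1 ?size_mkseq// => iln.
    rewrite nth_mkseq//= /x -(nth_take ord0 (ltnSn i)); congr nth.
    apply: stable_uniq (WP i.+1).2 _; rewrite ?size_takel ?(WP _).1//.
    by apply: stable_take; [exact: (WP n).2|rewrite (WP n).1].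
  exists (inr x) => t f.
  apply: (@Lterm_prefix _ _ _ (W (node_length t).+1)) => //.
  - by rewrite (WP _).1.
  - exact: (WP _).2.
  - by rewrite (WP _).1.
move=> /existsNP[n0 /forallNP n0P].
have [w [Uw wP]] : exists w, stable w /\ forall b, ~ stable (rcons w b).
  apply: contrapT => h; suff [w ?] : exists w, size w = n0 /\ stable w by exact: (n0P w).
  elim: n0 {n0P} => [|n [w [wn Uw]]]; first by exists [::].
  apply: contrapT => h'; apply: h; exists w; split=> // b Uwb; apply: h'.
  by exists (rcons w b); rewrite size_rcons wn.
have [Ult|Une] := in_ultra_setVsetC [set s | ge_length (size w).+1 s] UU; last first.
  have : exists s, U [set s' | s' = s].
    have [s []] := filter_ex (filterI Une Uw).
    case: s => [t|x] /=; last by [].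
    move=> /negP; rewrite -leqNgt => tw [wt]; have tE : node_length t = size w.
      by apply/eqP; rewrite eqn_leq tw.
    rewrite -tE initial_inl => tw'; exists (inl t).
    apply: filterS2 Une Uw => -[t'|x]/=; last by [].
    move=> /negP; rewrite -leqNgt => t'w [wt' t'E].
    have t'E' : node_length t' = size w by apply/eqP; rewrite eqn_leq t'w.
    by congr inl; apply: val_inj; rewrite -initial_inl t'E' t'E.
  by move=> [s Us]; exists s => t f; apply: Lterm_near_eq; apply: filterS Us => _ /= ->.
have [beta bP] := @ultra_ordtop_lim R _ U UU (fun s => Some (coord s (size w).+1)).
have sz b : rcons w b != [::] by case: (w).
(* If w is empty and beta is omega^omega, every term tends to 0; a branch of
   length 1 has no term. *)
pose s : branch := match beta with
  | Some b => inl (exist _ (rcons w b) (sz b))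
  | None => inl (insubd (exist _ [:: ord0] isT) w)
  end.
have sSome b : beta = Some b -> s = inl (exist _ (rcons w b) (sz b)).
  by rewrite /s => ->.
have sNone : beta = None -> w != [::] -> exists2 t, s = inl t & val t = w.
  rewrite /s => -> w0; eexists; first by [].
  by rewrite val_insubd w0.
have sNone0 : beta = None -> w = [::] -> s = inl (exist _ [:: ord0] isT).
  by rewrite /s => -> w0; rewrite /insubd insubF ?w0.
have sw : (0 < size w)%N -> ge_length (size w) s /\ w = initial s (size w).
  move=> w0; case E : beta => [b|].
    rewrite (sSome _ E) /= /node_length /= size_rcons leqnSn; split=> //.
    apply: (@eq_from_nth _ ord0) => [|i iw]; first by rewrite size_mkseq.
    by rewrite nth_mkseq//= nth_rcons iw.
  have [|t -> tw] := sNone E; first by rewrite -size_eq0 -lt0n.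
  by rewrite -tw initial_inl /= leqnn.
exists s => t f.
have [tw|wt] := ltnP (node_length t) (size w).
  by have [ws sE] := sw (leq_ltn_trans (leq0n _) tw); exact: Lterm_prefix sE ws.
have [tw|tw] := eqVneq (val t) w.
  have tl : node_length t = size w by rewrite /node_length tw.
  have -> : Lterm t f s = f beta.
    case E : beta => [b|].
      rewrite (sSome _ E) /Lterm asboolT; last first.
        apply/precedes_inl; rewrite /= /node_length /= size_rcons tw ltnSn.
        by rewrite -cats1 take_size_cat.
      by rewrite tl /= nth_rcons ltnn eqxx.
    have [|t' -> t'w] := sNone E; first by rewrite -tw; exact: (valP t).
    rewrite /Lterm asboolF; first by case: f => f /=; rewrite inE => -[_ ->].
    by move=> /precedes_inl[]; rewrite /node_length t'w tw ltnn.
  apply: cvg_trans (bP f); apply: near_eq_cvg.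
  apply: filterS2 Uw Ult => s' [/= _ s'w] ws'.
  by rewrite /Lterm asboolT ?tl//; apply/precedesE; rewrite tl tw.
have -> : Lterm t f s = 0.
  rewrite /Lterm asboolF//; case E : beta => [b|].
    rewrite (sSome _ E) => /precedes_inl[].
    rewrite {1 2}/node_length /= size_rcons ltnS => tw'.
    have tE : node_length t = size w by apply/eqP; rewrite eqn_leq wt andbT.
    by rewrite tE -cats1 take_size_cat// => /eqP; rewrite eq_sym (negbTE tw).
  have [w0|w0] := eqVneq w [::].
    rewrite (sNone0 E w0) => /precedes_inl[+ _].
    by rewrite [X in (_ < X)%N]/node_length /= ltnS leqNgt node_length_gt0.
  have [t' -> t'w] := sNone E w0; move=> /precedes_inl[+ _].
  by rewrite [X in (_ < X)%N]/node_length t'w ltnNge wt.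
apply: cvg_near_cst.
have [tE|tw'] := eqVneq (node_length t) (size w).
  apply: filterS Uw => s' [/= ws' s'w]; rewrite /Lterm asboolF// => /precedesE[_].
  by rewrite tE s'w => /esym/eqP; rewrite (negbTE tw).
have {tw'}wt' : (size w < node_length t)%N by rewrite ltn_neqAle eq_sym tw'.
have [/wP //|] := in_ultra_setVsetC
  [set s | ge_length (size (rcons w (nth ord0 (val t) (size w)))) s /\
     initial s (size (rcons w (nth ord0 (val t) (size w)))) =
       rcons w (nth ord0 (val t) (size w))] UU.
apply: filterS2 Uw => s' [/= ws' s'w]; rewrite size_rcons => h.
rewrite /Lterm asboolF// => /precedesE[ts' s't]; apply: h; split.
  by apply: ge_lengthS ts'; rewrite ltnW.
rewrite initial_rcons s'w -s't nth_mkseq//.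
Qed.

End Ultra.
End BranchCompact.

(** * Segment functionals and branch functionals *)

Section Segments.
Context {R : realType}.
Implicit Types (s : branch) (t : node) (F G H : X0 R) (p : branch * nat).

Definition Lbranch s F : R := Lfunctional (s, 1%N) F.

Lemma mem_support F t : F t != 0 -> t \in fset_set [set t | F t != 0].
Proof. by move=> Ft; rewrite in_fset_set ?inE//; exact: X0_finite. Qed.

Lemma Lfunctional_lin p (a : R) F G :
  Lfunctional p (a *: F + G) = a * Lfunctional p F + Lfunctional p G.
Proof. exact: (Lfunctional_linear p a F G). Qed.

Lemma LfunctionalD p F G :
  Lfunctional p (F + G) = Lfunctional p F + Lfunctional p G.
Proof. by have := Lfunctional_lin p 1 F G; rewrite scale1r mul1r. Qed.

Lemma seminorm_Lbranch s : is_seminorm (fun F => `|Lbranch s F|).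
Proof.
have L0 : Lfunctional (s, 1%N) 0 = 0 :> R.
  by apply: (addrI (Lfunctional (s, 1%N) 0)); rewrite -LfunctionalD !addr0.
split=> [F G|a F]; first by rewrite /Lbranch LfunctionalD ler_normD.
by rewrite /Lbranch -[a *: F]addr0 Lfunctional_lin L0 addr0 normrM.
Qed.

Lemma seminorm_X0_norm : is_seminorm (@X0_norm R).
Proof. by split; [exact: X0_norm_triangle|exact: X0_normZ]. Qed.

Lemma Lfunctional_le_norm p F : is_segment p -> `|Lfunctional p F| <= X0_norm F.
Proof.
move=> segp; have inc : incomparable_family [set p].
  by split=> [_ ->//|_ _ -> ->].
by have := X0_norm_ub F inc; rewrite fsbig_set1 sqrtr_sqr.
Qed.

Lemma Lbranch_le_norm s F : `|Lbranch s F| <= X0_norm F.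
Proof.
have [s1|s1] := boolP (lt_length 1 s); first by apply: Lfunctional_le_norm.
rewrite /Lbranch /Lfunctional fsbig1 ?normr0 ?X0_norm_ge0// => t [[]] /=.
rewrite !lt_lengthE => ts; move: s1; rewrite lt_lengthE => /negP[].
by apply: ge_lengthS ts; rewrite ltnS node_length_gt0.
Qed.

(** The default value only serves i = 0, where [initial s i] is empty. *)
Definition truncation s i : branch :=
  inl (insubd (exist _ [:: ord0] isT : node) (initial s i)).

Lemma Lfunctional_truncation s i F : is_segment (s, i) ->
  Lfunctional (s, i) F = Lbranch s F - Lbranch (truncation s i) F.
Proof.
move=> [/= i0 si].
have tiE : exists2 t', truncation s i = inl t' & val t' = initial s i.
  eexists; first by []; rewrite val_insubd ifT// -size_eq0 size_mkseq -lt0n.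
  exact: i0.
have [t' tE t'E] := tiE.
have sz : node_length t' = i by rewrite /node_length t'E size_mkseq.
set D := fset_set [set t | F t != 0].
have FD := @mem_support F.
apply/esym/eqP; rewrite subr_eq; apply/eqP/esym; rewrite /Lbranch.
rewrite !(Lfunctional_seq _ (fset_uniq _) FD) -big_split /=.
apply: eq_bigr => t _.
have inS q : (t \in segment_nodes q) = `[< segment_nodes q t >].
  by apply/idP/asboolP; rewrite inE.
have t0 : (1 <= node_length t)%N := node_length_gt0 t.
have -> : (t \in segment_nodes (truncation s i, 1%N)) =
    `[< precedes t s >] && (node_length t < i)%N.
  rewrite inS; apply/asboolP/andP => -[/=].
    rewrite tE => /precedes_inl[]; rewrite sz t'E => ti + _.
    rewrite initial_take ?(ltnW ti)// => h; split=> //; apply/asboolP/precedesE.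
    by split=> //; apply: ge_lengthS ti _; apply: ge_lengthS (leqnSn _) _; rewrite -lt_lengthE.
  move=> /asboolP/precedesE[ts h] ti; split=> //.
  by rewrite tE; apply/precedes_inl; rewrite sz t'E initial_take// ltnW.
have -> : (t \in segment_nodes (s, 1%N)) = `[< precedes t s >].
  by rewrite inS; apply/asboolP/asboolP => [[]|].
have -> : (t \in segment_nodes (s, i)) = `[< precedes t s >] && (i <= node_length t)%N.
  by rewrite inS; apply/asboolP/andP => -[/= /asboolP].
case: (`[< precedes t s >]) => /=; last by rewrite addr0.
case: leqP => ti; first by rewrite addr0.
by rewrite add0r /= (_ : insubd _ _ = t') ?t'E ?nth_mkseq//; case: tE.
Qed.

Lemma ultra_Lbranch_lim (U : set_system branch) : UltraFilter U ->
  exists s, forall F, Lbranch ^~ F @ U --> (Lbranch s F : R).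
Proof.
move=> UU; have [s sP] := @ultra_branch_lim R U UU; exists s => F.
set D := fset_set [set t | F t != 0].
have FD := @mem_support F.
have E s' : Lbranch s' F = \sum_(t <- D) Lterm t (F t) s'.
  exact: Lfunctional1E (fset_uniq _) FD.
rewrite E (_ : Lbranch ^~ F = fun s' => \sum_(t <- D) Lterm t (F t) s'); last exact/funext.
elim: (enum_fset D) => [|t r IH].
  rewrite big_nil; apply: cvg_near_cst; apply: nearW => s'; by rewrite big_nil.
rewrite big_cons.
under eq_fun do rewrite big_cons.
by apply: cvgD => //; exact: sP.
Qed.

(** The finite intersection property, for the closed sets
    [theta <= |L_s (z i)|] of branches. *)
Lemma branch_compact (z : nat -> X0 R) (theta : R) :
  (forall n, exists s, forall i, (i < n)%N -> theta <= `|Lbranch s (z i)|) ->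
  exists s, forall i, theta <= `|Lbranch s (z i)|.
Proof.
move=> /choice[sg sgP].
have [U [UU sU]] := ultraFilterLemma (fmap_proper_filter sg eventually_filter).
have [s sP] := ultra_Lbranch_lim UU; exists s => i.
rewrite leNgt; apply/negP => si.
have Ulow : U [set s' | theta <= `|Lbranch s' (z i)|].
  by apply: sU; exists i.+1 => // n /= iltn; exact: sgP.
have Uup : U [set s' | `|Lbranch s' (z i)| < theta].
  exact: (@cvgr_norm_lt _ R^o _ U filter_filter _ _ (sP (z i)) _ si).
by have [s' [/=]] := filter_ex (filterI Ulow Uup); rewrite leNgt => /negP.
Qed.

End Segments.

(** * Combinations that are small on all branches *)

HB.instance Definition _ := [Countable of ord by <:].
HB.instance Definition _ := Countable.on node.

Section SmallCombination.
Context {R : realType}.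
Implicit Types (s : branch) (t : node) (F y z : nat -> X0 R) (G H : X0 R).
Implicit Types (x : nat -> ord) (M theta eps : R).

Definition null_on_nodes y : Prop :=
  forall t, exists n0, forall n, (n0 <= n)%N -> Lbranch (inl t) (y n) = 0.

(** The n-th block is chosen in the kernels of the finitely many functionals given
    by finite branches of code at most n. *)
Lemma blocks_null_on_nodes F : exists2 y, blocks F y & null_on_nodes y.
Proof.
have [|y Fy yP] := @blocks_exist _ _ F (fun i G =>
    forall t, (choice.pickle t <= i)%N -> Lbranch (inl t) G = 0).
  move=> m i.
  have [//|n [G [FG G0]]] := @lcomb_kernel _ _ node (fun t => Lbranch (inl t)) F
    (pmap choice.unpickle (iota 0 i.+1)) m.
    by move=> t a u v; exact: Lfunctional_lin.
  exists n, G; split=> // t ti; apply: G0.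
  by rewrite mem_pmap -[Some t]choice.pickleK map_f// mem_iota.
by exists y => // t; exists (choice.pickle t) => n; exact: yP.
Qed.

Lemma subseq_exist (Q : nat -> Prop) :
  (forall K, exists2 k, (K <= k)%N & Q k) ->
  exists2 phi : nat -> nat, {homo phi : i j / (i < j)%N} & forall n, Q (phi n).
Proof.
move=> h; have /choice[g gP] : forall K, exists k, (K <= k)%N /\ Q k.
  by move=> K; have [k] := h K; exists k.
pose phi := fix phi n := if n is n'.+1 then g (phi n').+1 else g 0%N.
exists phi; last by case=> [|n]; exact: (gP _).2.
by apply: homo_ltn => [|i]; [exact: ltn_trans|exact: (gP (phi i).+1).1].
Qed.

Lemma separation (xs : seq (nat -> ord)) :
  exists m, forall x x', x \in xs -> x' \in xs -> x <> x' ->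
    exists2 j, (j < m)%N & x j <> x' j.
Proof.
have /choice[d dP] : forall xx : (nat -> ord) * (nat -> ord), exists j,
    xx.1 <> xx.2 -> xx.1 j <> xx.2 j.
  move=> [x x'] /=; have [->|xx'] := pselect (x = x'); first by exists 0%N.
  suff [j jP] : exists j, x j <> x' j by exists j.
  apply: contrapT => h; apply: xx'; apply/funext => j; apply: contrapT => jj.
  by apply: h; exists j.
exists (\max_(xx <- [seq (x, x') | x <- xs, x' <- xs]) d xx).+1 => x x' xs_x xs_x' xx'.
exists (d (x, x')); last exact: dP (x, x') xx'.
by rewrite ltnS; apply: leq_bigmax_seq => //; exact: allpairs_f.
Qed.

(** Beyond a level m at which the branches are pairwise different, they are
    pairwise incomparable segments, so the squares of their values at y k sum to
    at most the square of its norm.  These values are the full L_s (y k) once y k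
    vanishes on the branches truncated at m. *)
Lemma few_large_branches y M theta (xs : seq (nat -> ord)) :
  null_on_nodes y -> (forall k, X0_norm (y k) <= M) -> 0 <= theta -> uniq xs ->
  (forall n, exists2 k, (n <= k)%N &
    forall x, x \in xs -> theta <= `|Lbranch (inr x) (y k)|) ->
  (size xs)%:R * theta ^+ 2 <= M ^+ 2.
Proof.
move=> y0 yM theta0 uxs xslarge.
have [m' m'P] := separation xs.
pose m := m'.+1.
have mP x x' : x \in xs -> x' \in xs -> x <> x' -> exists2 j, (j < m)%N & x j <> x' j.
  by move=> ? ? /m'P[]// j jm' ?; exists j => //; exact: ltnW.
have sz x : initial (inr x) m != [::] by [].
pose tr x : node := exist _ (initial (inr x) m) (sz x).
have /choice[n0 n0P] : forall x, exists n0, forall n, (n0 <= n)%N ->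
  Lbranch (inl (tr x)) (y n) = 0 by move=> x; exact: y0.
have [k nk kP] := xslarge (\max_(x <- xs) n0 x).
have segm x : is_segment (inr x, m) by [].
have trE x : truncation (inr x) m = inl (tr x).
  by congr inl; apply: val_inj; rewrite val_insubd.
have LE x : x \in xs -> Lfunctional (inr x, m) (y k) = Lbranch (inr x) (y k).
  move=> xsx; rewrite Lfunctional_truncation// trE n0P ?subr0//.
  by apply: leq_trans nk; exact: leq_bigmax_seq.
pose f x : branch * nat := (inr x, m).
pose S : set (branch * nat) := [set` map f xs].
have incS : incomparable_family S.
  split=> [_ /mapP[x _ ->]//|_ _ /mapP[x xsx ->] /mapP[x' xsx' ->] xx'].
  have [|j jm jP] := mP x x' xsx xsx'; first by move=> E; apply: xx'; rewrite E.
  split; last by exists j.+1; rewrite /= minnn; split.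
  apply/seteqP; split=> // t [[/precedes_inr xt mt] [/precedes_inr x't _]].
  apply: jP; have jt : (j < node_length t)%N by exact: leq_trans jm mt.
  by have := congr1 (nth ord0 ^~ j) xt; rewrite -x't !nth_mkseq.
have um : uniq (map f xs) by rewrite map_inj_uniq// => x x' [].
have := X0_norm_ub (y k) incS.
rewrite (@sumsq_seq _ S _ _ um)//.
rewrite big_map => le1.
have M0 : 0 <= M by exact: le_trans (X0_norm_ge0 _) (yM 0%N).
have sumle : \sum_(x <- xs) Lfunctional (f x) (y k) ^+ 2 <= M ^+ 2.
  rewrite -(sqr_sqrtr (sumr_ge0 _ _)); last by move=> i _; exact: sqr_ge0.
  by rewrite ler_pXn2r ?nnegrE ?sqrtr_ge0// (le_trans le1).
apply: le_trans sumle.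
have -> : (size xs)%:R * theta ^+ 2 = \sum_(x <- xs) theta ^+ 2.
  by rewrite big_const_seq count_predT iter_addr_0 mulr_natl.
rewrite [leLHS]big_seq [leRHS]big_seq; apply: ler_sum => x xsx.
by rewrite LE// -[leRHS]real_normK ?num_real// ler_pXn2r ?nnegrE ?normr_ge0 ?kP.
Qed.

(** If every subsequence left some new branch large infinitely often, then
    passing to further subsequences would make arbitrarily many branches
    large simultaneously. *)
Lemma few_limsup_branches y M theta :
  null_on_nodes y -> (forall k, X0_norm (y k) <= M) -> 0 < theta ->
  exists (phi : nat -> nat) (xs : seq (nat -> ord)),
    {homo phi : i j / (i < j)%N} /\
    forall x, x \notin xs -> exists K, forall k, (K <= k)%N ->
      `|Lbranch (inr x) (y (phi k))| < theta.
Proof.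
move=> y0 yM theta0; apply: contrapT => h.
have large r : exists (phi : nat -> nat) (xs : seq (nat -> ord)),
    [/\ {homo phi : i j / (i < j)%N}, uniq xs, size xs = r &
    forall x, x \in xs -> forall k, theta <= `|Lbranch (inr x) (y (phi k))|].
  elim: r => [|r [phi [xs [phi_lt uxs xsr xsP]]]]; first by exists id, [::]; split.
  have [x xxs xP] : exists2 x, x \notin xs & forall K, exists2 k, (K <= k)%N &
      theta <= `|Lbranch (inr x) (y (phi k))|.
    apply: contrapT => h'; apply: h; exists phi, xs; split=> // x xxs.
    apply: contrapT => /forallNP xK; apply: h'; exists x => // K.
    have /existsNP[k /not_implyP[Kk /negP]] := xK K.
    by rewrite -leNgt => ?; exists k.
  have [psi psi_lt psiP] := subseq_exist xP.
  exists (phi \o psi), (x :: xs); split=> /=.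
  - by move=> i j ij; apply/phi_lt/psi_lt.
  - by rewrite xxs.
  - by rewrite xsr.
  - by move=> x'; rewrite inE => /predU1P[->|/xsP].
pose r := (Num.truncn (M ^+ 2 / theta ^+ 2)).+1.
have [phi [xs [phi_lt uxs xsr xsP]]] := large r.
have := @few_large_branches y M theta xs y0 yM (ltW theta0) uxs.
rewrite xsr -ler_pdivlMr ?exprn_gt0// leNgt truncnS_gt => /= few.
suff : false by []; apply: few => n.
exists (phi n); last by move=> x xxs; exact: xsP.
exact: increasing_ge.
Qed.

Lemma blocks_sub F y (phi : nat -> nat) : {homo phi : i j / (i < j)%N} ->
  blocks F y -> blocks F (y \o phi).
Proof.
move=> phi_lt [p hp]; exists (p \o phi) => n; apply: lcomb_widenr (hp (phi n)).
by rewrite ltnW ?(lcomb1_lt (hp _))//= (ltnW_homo (blocks_lt hp))// phi_lt.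
Qed.

(** The blocks z are annihilated by the finitely many infinite branches that stay
    large along y, and vanish eventually on each finite branch; so each single
    branch is eventually at most theta on them. *)
Lemma small_lcomb F M eps : (forall k, X0_norm (F k) <= M) -> 0 < eps ->
  exists n G, lcomb F 0 n 1 G /\ forall s, `|Lbranch s G| <= eps.
Proof.
move=> FM eps0; pose theta := eps / 4.
have theta0 : 0 < theta by rewrite divr_gt0.
have bounded y : blocks F y -> forall k, X0_norm (y k) <= M.
  move=> [p hp] k; rewrite -[M]mul1r.
  by apply: lcomb_le seminorm_X0_norm (hp k) _ => j _; exact: FM.
have [y Fy y0] := blocks_null_on_nodes F.
have [phi [xs [phi_lt xsP]]] := few_limsup_branches y0 (bounded y Fy) theta0.
have [|z yz zxs] := @blocks_exist _ _ (y \o phi) (fun _ G =>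
    forall x, x \in xs -> Lbranch (inr x) G = 0).
  move=> m _; have [//|n [G [yG G0]]] := @lcomb_kernel _ _ _
    (fun x : nat -> ord => @Lbranch R (inr x)) (y \o phi) xs m.
    by move=> t a u v; exact: Lfunctional_lin.
  by exists n, G.
have Fz : blocks F z by apply: blocks_trans yz; exact: blocks_sub.
have z_small s : exists n0, forall n, (n0 <= n)%N -> `|Lbranch s (z n)| <= theta.
  have [q hq] := yz.
  have tail c n0 : (forall k, (n0 <= k)%N -> `|Lbranch s (y (phi k))| <= c) ->
      forall n, (n0 <= n)%N -> `|Lbranch s (z n)| <= c.
    move=> h n n0n; rewrite -[c]mul1r.
    apply: lcomb_le (seminorm_Lbranch s) (hq n) _ => k /andP[qk _].
    by apply: h; rewrite (leq_trans n0n)// (leq_trans (blocks_ge hq n)).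
  case: s tail => [t|x] tail.
    have [n0 n0P] := y0 t; exists n0; apply: tail => k n0k.
    by rewrite n0P ?normr0 ?(ltW theta0)// (leq_trans n0k)// increasing_ge.
  have [xxs|/xsP[K KP]] := boolP (x \in xs).
    by exists 0%N => n _; rewrite zxs// normr0 ltW.
  by exists K; apply: tail => k /KP/ltW.
have zM s k : `|Lbranch s (z k)| <= M.
  by apply: le_trans (Lbranch_le_norm s _) _; exact: bounded.
have tt0 : 0 < theta + theta by rewrite addr_gt0.
(* The threshold is 2 theta, to leave a gap above the pointwise bound theta. *)
have [|n [G [zG GP]]] := @ptak R _ branch (fun s (G : X0 R) => `|Lbranch s G|) z M
    (theta + theta) seminorm_Lbranch (ltW tt0) zM _ (theta + theta) tt0.
  move=> kappa kappa_lt; apply: contrapT => /forallNP hn.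
  have [|s sP] := @branch_compact R (z \o kappa) (theta + theta).
    move=> n; have /existsNP[s sP] := hn n; exists s => i iltn.
    by rewrite leNgt; apply/negP => lt; apply: sP; exists i.
  have [n0 n0P] := z_small s.
  have := le_trans (sP n0) (n0P _ (increasing_ge kappa_lt n0)).
  by rewrite gerDl leNgt theta0.
have [p hp] := Fz; exists (p n), G; split.
  apply: lcomb_widenl (blocks_lcomb hp (leq0n n) zG).
  by rewrite leq0n (ltnW_homo (blocks_lt hp)).
move=> s; apply: le_trans (GP s) _.
by rewrite /theta; lra.
Qed.

End SmallCombination.

(** * Combinations of mass N and norm of order sqrt N *)

Section SlowGrowth.
Context {R : realType}.
Implicit Types (s : branch) (t : node) (F : nat -> X0 R) (G H : X0 R).
Implicit Types (p : branch * nat) (S : set (branch * nat)) (M : R).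

(** Incomparable segments are disjoint, so each node of the finite support of H
    contributes to at most one of them. *)
Lemma sum_Lfunctional_bound H : exists2 C : R, 0 <= C & forall S r,
  incomparable_family S -> uniq r -> (forall p, p \in r -> S p) ->
  \sum_(p <- r) `|Lfunctional p H| <= C.
Proof.
have /choice[B BP] : forall t, exists B : R, forall x, `|H t x| <= B.
  by move=> t; exact: C0_bounded.
have B0 t : 0 <= B t by exact: le_trans (normr_ge0 _) (BP t None).
set D := fset_set [set t | H t != 0].
have HD := @mem_support R H.
exists (\sum_(t <- D) B t) => [|S r [_ incS] ur rS]; first exact: sumr_ge0.
apply: (@le_trans _ _ (\sum_(p <- r) \sum_(t <- D)
    if t \in segment_nodes p then B t else 0)).
  apply: ler_sum => p _; rewrite (Lfunctional_seq p (fset_uniq _) HD).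
  apply: le_trans (ler_norm_sum _ _ _) _; apply: ler_sum => t _.
  by case: ifP => _; rewrite ?normr0.
rewrite exchange_big /=; apply: ler_sum => t _.
have [[p pr tp]|none] := pselect (exists2 p, p \in r & t \in segment_nodes p).
  rewrite (big_rem p pr) /= tp big_seq big1 ?addr0// => q.
  rewrite (mem_rem_uniq _ ur) inE => /andP[/eqP qp qr]; case: ifP => // tq.
  have [disj _] := incS _ _ (rS _ qr) (rS _ pr) qp.
  by have : (segment_nodes q `&` segment_nodes p) t;
    [split; exact: set_mem|rewrite disj].
rewrite big_seq big1// => p pr; case: ifP => // tp.
by exfalso; apply: none; exists p.
Qed.

(** The cross terms of the squares are controlled in l1 on the side of H and
    uniformly on the side of G: a segment functional is at most 2 eps at G, and
    the factor 4 C eps is at most 1. *)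
Lemma X0_normD_almost_orthogonal H : exists2 eps : R, 0 < eps & forall G,
  (forall s, `|Lbranch s G| <= eps) ->
  X0_norm (H + G) ^+ 2 <= X0_norm H ^+ 2 + X0_norm G ^+ 2 + 1.
Proof.
have [C C0 HC] := sum_Lfunctional_bound H.
have C4 : 0 < 4 * (C + 1) by rewrite mulr_gt0// ltr_wpDl.
exists (4 * (C + 1))^-1; first by rewrite invr_gt0.
set eps := _^-1 => G Gs.
have GP p : is_segment p -> `|Lfunctional p G| <= 2 * eps.
  case: p => s i segp; rewrite Lfunctional_truncation//.
  by rewrite (le_trans (ler_normB _ _))// mulr_natl mulr2n lerD.
set RHS := leRHS; have RHS0 : 0 <= RHS by rewrite !addr_ge0// sqr_ge0.
suff : X0_norm (H + G) <= Num.sqrt RHS.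
  move=> h; rewrite -[leRHS](sqr_sqrtr RHS0).
  by rewrite ler_pXn2r ?nnegrE ?X0_norm_ge0 ?sqrtr_ge0.
apply: X0_norm_le => S incS; rewrite ler_sqrt//.
set A := [set p | S p /\ Lfunctional p H != 0] `|`
         [set p | S p /\ Lfunctional p G != 0].
have fA : finite_set A.
  by rewrite finite_setU; split; exact: incomparable_family_finite.
have u := fset_uniq (fset_set A).
have rS p : p \in fset_set A -> S p by rewrite in_fset_set// inE => -[[]|[]].
have hH p : S p -> Lfunctional p H != 0 -> p \in fset_set A.
  by move=> Sp L0; rewrite in_fset_set// inE; left.
have hG p : S p -> Lfunctional p G != 0 -> p \in fset_set A.
  by move=> Sp L0; rewrite in_fset_set// inE; right.
have hHG p : S p -> Lfunctional p (H + G) != 0 -> p \in fset_set A.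
  move=> Sp; rewrite LfunctionalD; have [L0|L0] := eqVneq (Lfunctional p H) 0.
    by rewrite L0 add0r; exact: hG.
  by move=> _; exact: hH.
rewrite (sumsq_seq u rS hHG).
have sum_le K : (forall p, S p -> Lfunctional p K != 0 -> p \in fset_set A) ->
    \sum_(p <- fset_set A) Lfunctional p K ^+ 2 <= X0_norm K ^+ 2.
  move=> hK; have := X0_norm_ub K incS; rewrite (sumsq_seq u rS hK) => h.
  have s0 : 0 <= \sum_(p <- fset_set A) Lfunctional p K ^+ 2.
    by apply: sumr_ge0 => p _; exact: sqr_ge0.
  by rewrite -(sqr_sqrtr s0) ler_pXn2r ?nnegrE ?sqrtr_ge0 ?X0_norm_ge0.
apply: (@le_trans _ _ (\sum_(p <- fset_set A) (Lfunctional p H ^+ 2 +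
    Lfunctional p G ^+ 2 + (4 * eps) * `|Lfunctional p H|))).
  rewrite [leLHS]big_seq [leRHS]big_seq; apply: ler_sum => p /rS Sp.
  rewrite LfunctionalD sqrrD addrAC lerD2l -mulr_natl.
  apply: le_trans (ler_norm _) _; rewrite !normrM normr_nat.
  have := ler_wpM2l (normr_ge0 (Lfunctional p H)) (GP p (incS.1 p Sp)).
  lra.
rewrite !big_split /= !lerD// ?sum_le//.
rewrite -mulr_sumr (le_trans (ler_wpM2l _ (HC _ _ incS u rS)))//.
  by rewrite mulr_ge0// invr_ge0 ltW.
rewrite /eps invfM mulrA divff// mul1r mulrC ler_pdivrMr ?mul1r ?ltr_wpDl//.
by rewrite lerDl.
Qed.

Lemma slow_growth F M : (forall k, X0_norm (F k) <= M) -> forall N,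
  exists n G, lcomb F 0 n N%:R G /\ X0_norm G ^+ 2 <= N%:R * (M ^+ 2 + 1).
Proof.
move=> FM; elim=> [|N [n [H [FH Hle]]]].
  exists 0%N, 0; split; first exact: lcomb_empty.
  by rewrite mul0r (_ : X0_norm 0 = 0) ?expr0n//; exact: (@normr0 _ (X0 R)).
have [eps eps0 HP] := X0_normD_almost_orthogonal H.
have [m [G [FG GP]]] := small_lcomb (fun k => FM (k + n)%N) eps0.
have FG' := (lcomb_shift _ _ _ _ _ _).1 FG.
have M0 : 0 <= M by exact: le_trans (X0_norm_ge0 _) (FM 0%N).
have GM : X0_norm G <= M.
  by rewrite -[M]mul1r; apply: lcomb_le seminorm_X0_norm FG' _ => k _; exact: FM.
exists (m + n)%N, (H + G); split.
  by rewrite -natr1; apply: lcomb_cat FH FG'; rewrite leq0n leq_addl.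
apply: le_trans (HP _ GP) _.
rewrite -natr1 mulrDl mul1r -addrA !lerD//.
by rewrite ler_pXn2r ?nnegrE// X0_norm_ge0.
Qed.

End SlowGrowth.

(** * Sequences of X0 given by an embedded l1 *)

Section EmbeddedL1.
Context {R : realType}.

Let unit_seq k : nat -> R^o := fun j => (j == k)%:R.

Let unit_seq_cvg k : [normed series (unit_seq k)] @ \oo --> (1 : R).
Proof.
apply: cvg_near_cst; exists k.+1 => // n /= kn.
rewrite /series /= (big_cat_nat (leq0n k.+1) kn) /= big_nat_recr//=.
rewrite /unit_seq eqxx normr1 !big1_seq ?add0r ?addr0// => i /=;
  rewrite mem_index_iota => /andP[ki ik].
  by rewrite gtn_eqF// normr0.
by rewrite ltn_eqF// normr0.
Qed.

Let unit_seq_l1 k : unit_seq k \in @l1_pred R.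
Proof. by rewrite inE; apply: cvgP (unit_seq_cvg k). Qed.

Definition l1_unit k : l1 R := Mkl1 (unit_seq_l1 k).

Lemma norm_l1_unit k : `|l1_unit k| = 1.
Proof. by rewrite /Num.norm /= /l1_norm; apply/cvg_lim => //; exact: unit_seq_cvg. Qed.

Lemma l1_partial_sum_le (a : l1 R) n : \sum_(0 <= k < n) `|a k| <= `|a|.
Proof.
have ca : cvgn [normed series a] by case: a => a /=; rewrite inE.
apply: (nondecreasing_cvgn_le _ ca); apply: nondecreasing_series => k _ _.
exact: normr_ge0.
Qed.

Lemma l1_unit_comb (a : nat -> R) n j : (j < n)%N ->
  (\sum_(0 <= k < n) a k *: l1_unit k : l1 R) j = a j.
Proof.
have E : (\sum_(0 <= k < n) a k *: l1_unit k : l1 R) j =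
    \sum_(0 <= k < n) a k * (j == k)%:R.
  by elim/big_ind2 : _ => // x x' y y' <- <-.
move=> jn; rewrite E (big_cat_nat (leq0n j.+1) jn) /= big_nat_recr//= eqxx mulr1.
rewrite !big1_seq ?add0r ?addr0// => i /=; rewrite mem_index_iota => /andP[ki ik].
  by rewrite ltn_eqF// mulr0.
by rewrite gtn_eqF// mulr0.
Qed.

Lemma subspace_embedding_bounds (E F : normedModType R) (T : {linear E -> F})
    (S : F -> E) : continuous T -> cancel T S -> {within range T, continuous S} ->
  exists (c d : R), [/\ 0 < d, forall a, d * `|a| <= `|T a| &
    forall a, `|a| <= 1 -> `|T a| <= c].
Proof.
move=> cT TS cS.
have [e e0 eP] : exists2 e : R, 0 < e & forall a, `|a| < e -> `|T a| < 1.
  have T0 : T x @[x --> 0] --> (0 : F) by have := cT 0; rewrite /continuous_at linear0.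
  have := @cvgr_norm_lt _ F _ _ (@nbhs_filter E 0) _ _ T0 1.
  rewrite normr0 => /(_ ltr01) /nbhs_ballP[e /= e0 eP]; exists e => // a ae.
  by apply: eP; rewrite -ball_normE /= sub0r normrN.
have S0 : S 0 = 0 by rewrite -(linear0 T) TS.
have [r r0 rP] : exists2 r : R, 0 < r & forall a, `|T a| < r -> `|a| < 1.
  have S0c : S x @[x --> within (range T) (nbhs (0 : F))] --> (0 : E).
    have /subspace_continuousP cS' := cS.
    rewrite -[X in _ --> X]S0; apply: cS'; exists 0 => //; exact: linear0.
  have := @cvgr_norm_lt _ E _ _ (within_filter _ (nbhs_filter _)) _ _ S0c 1.
  rewrite normr0 => /(_ ltr01) /nbhs_ballP[r /= r0 rP]; exists r => // a ar.
  rewrite -[a]TS; apply: rP; last by exists a.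
  by rewrite -ball_normE /= sub0r normrN.
exists (2 / e), (r / 2); split; first by rewrite divr_gt0.
- move=> a; rewrite leNgt; apply/negP => Ta.
  have a0 : 0 < `|a|.
    rewrite normr_gt0; apply: contraTneq Ta => ->.
    by rewrite linear0 !normr0 mulr0 ltxx.
  have := rP (`|a|^-1 *: a); rewrite linearZ !normrZ normfV normr_id.
  rewrite mulVf ?gt_eqF// ltxx => h; suff : false by []; apply: h.
  rewrite ltr_pdivrMl// (lt_le_trans Ta)//.
  by have := mulr_gt0 r0 a0; lra.
- move=> a a1; have := eP ((e / 2) *: a); rewrite linearZ (normrZ _ a) (normrZ _ (T a)).
  have e2 : 0 < e / 2 by rewrite divr_gt0.
  rewrite (gtr0_norm e2) -(ler_pM2l e2) => h; apply/ltW.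
  have -> : e / 2 * (2 / e) = 1 by rewrite mulrA divfK ?divff ?gt_eqF.
  apply: h; apply: le_lt_trans (_ : e / 2 * 1 < e); first by rewrite ler_wpM2l// ltW.
  by rewrite mulr1 ltr_pdivrMr// ltr_pMr// ltr1n.
Qed.

End EmbeddedL1.

Section Transfer.
Context {R : realType}.

Lemma dense_near (X : normedModType R) (A : set X) (x : X) (r : R) :
  dense A -> 0 < r -> exists2 y, A y & `|y - x| < r.
Proof.
move=> dA r0; have [||y [xy Ay]] := dA (ball x r).
- by exists x; exact: ballxx.
- exact: ball_open.
by exists y => //; move: xy; rewrite -ball_normE /= distrC.
Qed.

(** An error of d / 2 in each image of a unit vector costs at most d / 2 times
    the mass of the combination, by the triangle inequality. *)
Lemma completion_l1_sequence (X : completeNormedModType R)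
    (iota : {linear X0 R -> X}) : is_completion iota ->
  isomorphic_to_subspace (l1 R) X ->
  exists (F : nat -> X0 R) (M d : R), [/\ 0 < d,
    forall k, X0_norm (F k) <= M &
    forall n w G, lcomb F 0 n w G -> d * w <= X0_norm G].
Proof.
move=> [iota_norm iota_dense] [T [S [cT TS cS]]].
have [c [d [d0 dT cT1]]] := subspace_embedding_bounds cT TS cS.
have d2 : 0 < d / 2 by rewrite divr_gt0.
have /choice[F FP] : forall k, exists G, `|iota G - T (l1_unit k)| < d / 2.
  move=> k; have [_ [G _ <-] Gk] := dense_near (T (l1_unit k)) iota_dense d2.
  by exists G.
have normE G : X0_norm G = `|iota G| by rewrite iota_norm.
exists F, (d / 2 + c), (d / 2); split => //.
  move=> k; rewrite normE -[iota _](subrK (T (l1_unit k))).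
  apply: le_trans (ler_normD _ _) _; apply: lerD; first exact/ltW.
  by apply: cT1; rewrite norm_l1_unit.
move=> n w G [a [-> <-]]; rewrite normE.
pose b : l1 R := \sum_(0 <= k < n) a k *: l1_unit k.
have bn : \sum_(0 <= k < n) `|a k| <= `|b|.
  apply: le_trans (l1_partial_sum_le b n).
  rewrite [leLHS]big_nat [leRHS]big_nat; apply: ler_sum => k /andP[_ kn].
  by rewrite l1_unit_comb.
have -> : iota (\sum_(0 <= k < n) a k *: F k) =
    T b - \sum_(0 <= k < n) a k *: (T (l1_unit k) - iota (F k)).
  rewrite /b (linear_sum iota) (linear_sum T) -sumrB; apply: eq_bigr => k _.
  by rewrite [iota _]linearZ [T (a k *: _)]linearZ /= scalerBr opprB addrC subrK.
apply: le_trans (lerB_dist _ _); rewrite lerBrDr.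
apply: (@le_trans _ _ (d * \sum_(0 <= k < n) `|a k|)); last first.
  by apply: le_trans (dT b); rewrite ler_wpM2l// ltW.
rewrite [d in leRHS]splitr mulrDl lerD2l.
apply: le_trans (ler_norm_sum _ _ _) _; rewrite mulr_sumr.
apply: ler_sum => k _; rewrite normrZ mulrC ler_wpM2r// distrC ltW//.
Qed.

End Transfer.

Theorem proposition6p1 (R : realType) (X : completeNormedModType R)
    (iota : {linear X0 R -> X}) (hX : is_completion iota) :
  ~ isomorphic_to_subspace (l1 R) X.
Proof.
move=> /(completion_l1_sequence hX)[F [M [d [d0 FM Fd]]]].
pose N := (Num.truncn ((M ^+ 2 + 1) / d ^+ 2)).+1.
have [n [G [FG Gle]]] := slow_growth FM N.
have d20 : 0 < d ^+ 2 by rewrite exprn_gt0.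
have N0 : 0 < N%:R :> R by rewrite ltr0n.
have : (d * N%:R) ^+ 2 <= N%:R * (M ^+ 2 + 1).
  apply: le_trans Gle; rewrite ler_pXn2r ?nnegrE ?X0_norm_ge0//; first exact: Fd FG.
  by rewrite mulr_ge0// ltW.
rewrite exprMn mulrC [N%:R ^+ 2]expr2 -mulrA ler_pM2l// -ler_pdivlMr//.
by rewrite leNgt truncnS_gt.
Qed.
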